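(* Let $G\subseteq\mathcal H$ be a rational geodesic. For $\Delta>0$ let $\mathrm{RM}^{\cap G}_\Delta\subseteq G$ denote the set of intersection points with $G$ of those RM curves of discriminant $D\le\Delta$ that intersect $G$ perpendicularly. Then, as $\Delta\to\infty$, $\mathrm{RM}^{\cap G}_\Delta$ is equidistributed along $G$ with respect to the hyperbolic metric $ds_{\mathrm{hyp}}$; that is, for all compact subarcs (closed bounded intervals) $J_1\subseteq J_2\subseteq G$ such that $J_2$ has nonzero hyperbolic length, $$\lim_{\Delta\to\infty}\frac{\#\,(J_1\cap \mathrm{RM}^{\cap G}_\Delta)}{\#\,(J_2\cap \mathrm{RM}^{\cap G}_\Delta)}=\frac{\mathrm{length}_{\mathrm{hyp}}(J_1)}{\mathrm{length}_{\mathrm{hyp}}(J_2)}.$$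
   Context: $\mathcal H=\{z=x+iy\in\mathbb C: y>0\}$, with hyperbolic metric $ds_{\mathrm{hyp}}=\sqrt{dx^2+dy^2}/y$. Geodesics in $\mathcal H$ are the vertical half-lines $G_x=\{x+iy: y\in(0,\infty)\}$ ($x\in\mathbb R$) and the semicircles $G_{q,r}=\{q+re^{i\theta}:\theta\in(0,\pi)\}$ ($q\in\mathbb R$, $r>0$). On $G_x$ (parametrized by $y$) the metric restricts to $ds_{\mathrm{hyp}}=\frac1y\,dy$; on $G_{q,r}$ (parametrized by $\theta$) it restricts to $ds_{\mathrm{hyp}}=\frac{1}{\sin\theta}\,d\theta$. A geodesic $G_x$ is rational if $x\in\mathbb Q$; a geodesic $G_{q,r}$ is rational if $q\in\mathbb Q$ and $r^2\in\mathbb Q$. A binary quadratic form is an integer triple $(a,b,c)$ (standing for $ax^2+bxy+cy^2$), with discriminant $b^2-4ac$; it is normalized if $\gcd(a,b,c)=1$ and the first nonzero entry of $(a,b,c)$ is positive. An RM curve is the semicircle in $\mathcal H$ (centered on the real axis) connecting the two real roots of $az^2+bz+c$, where $(a,b,c)$ is a normalized binary quadratic form of positive discriminant with $a\neq0$; its discriminant is $b^2-4ac$. *)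

(* Defs.v *)
From HB Require Import structures.
From mathcomp Require Import all_boot all_order all_algebra.
From mathcomp Require Import finmap complex.
From mathcomp Require Import all_classical all_reals all_analysis.
Set Implicit Arguments.
Unset Strict Implicit.
Unset Printing Implicit Defensive.
Import Order.TTheory GRing.Theory Num.Theory.
Import numFieldNormedType.Exports.
Local Open Scope classical_set_scope.
Local Open Scope complex_scope.
Local Open Scope ring_scope.

Definition upper_half_plane (R : realType) : set R[i] :=
  [set z | 0 < complex.Im z].

(* The hyperbolic metric (dx^2 + dy^2) / y^2 at the point z, with tangent
   vectors written as complex numbers. *)
Definition hyp_inner (R : realType) (z u v : R[i]) : R :=
  (complex.Re u * complex.Re v + complex.Im u * complex.Im v) /
  complex.Im z ^+ 2.

Definition hyp_norm (R : realType) (z u : R[i]) : R :=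
  Num.sqrt (hyp_inner z u u).

Definition velocity (R : realType) (f : R -> R[i]) (t : R) : R[i] :=
  derive1 (fun u => complex.Re (f u)) t +i*
  derive1 (fun u => complex.Im (f u)) t.

Variant geodesic (R : realType) :=
  | Vertical of R
  | Semicircle of R & {posnum R}.

Definition geo_dom (R : realType) (G : geodesic R) : set R :=
  match G with
  | Vertical _ => [set y | 0 < y]
  | Semicircle _ _ => [set theta | 0 < theta < pi]
  end.

Definition geo_param (R : realType) (G : geodesic R) (t : R) : R[i] :=
  match G with
  | Vertical x => x +i* t
  | Semicircle q r => (q + r%:num * cos t) +i* (r%:num * sin t)
  end.

Definition geo_points (R : realType) (G : geodesic R) : set R[i] :=
  geo_param G @` geo_dom G.

Lemma geo_points_upper (R : realType) (G : geodesic R) :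
  geo_points G `<=` @upper_half_plane R.
Proof.
case: G => [x|q r] z [t /= ht <-] //=.
by rewrite /upper_half_plane/= mulr_gt0// sin_gt0_pi.
Qed.

Definition rational_geodesic (R : realType) (G : geodesic R) : Prop :=
  match G with
  | Vertical x => @rational R x
  | Semicircle q r => @rational R q /\ @rational R (r%:num ^+ 2)
  end.

(* The compact subarc of G between the parameters s and t. *)
Definition subarc (R : realType) (G : geodesic R) (s t : R) : set R[i] :=
  geo_param G @` `[s, t].

Definition subarc_bounds (R : realType) (G : geodesic R) (s t : R) : Prop :=
  [/\ geo_dom G s, geo_dom G t & s <= t].

Definition hyp_length (R : realType) (G : geodesic R) (s t : R) : R :=
  \int[lebesgue_measure]_(u in `[s, t])
    hyp_norm (geo_param G u) (velocity (geo_param G) u).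

(* The angle is measured with the metric, between the tangent directions of
   the two geodesics at p. *)
Definition perpendicular_at (R : realType) (G H : geodesic R) (p : R[i]) :
    Prop :=
  exists s t : R,
    [/\ geo_dom G s, geo_dom H t, geo_param G s = p, geo_param H t = p &
      hyp_inner p (velocity (geo_param G) s) (velocity (geo_param H) t) = 0].

(* BQF a b c stands for a x^2 + b x y + c y^2. *)
Record bqf := BQF { bqf_a : int; bqf_b : int; bqf_c : int }.

Definition disc (Q : bqf) : int :=
  bqf_b Q ^+ 2 - 4 * bqf_a Q * bqf_c Q.

Definition normalized (Q : bqf) : Prop :=
  let: BQF a b c := Q in
  gcdz (gcdz a b) c = 1 /\
  [\/ 0 < a, a = 0 /\ 0 < b | [/\ a = 0, b = 0 & 0 < c]].

Definition is_root (R : realType) (Q : bqf) (x : R) : Prop :=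
  (bqf_a Q)%:~R * x ^+ 2 + (bqf_b Q)%:~R * x + (bqf_c Q)%:~R = 0.

(* Since r > 0, the endpoints q - r and q + r of the semicircle are distinct,
   hence they are the two real roots. *)
Definition RM_curve (R : realType) (Q : bqf) (C : geodesic R) : Prop :=
  [/\ normalized Q, 0 < disc Q, bqf_a Q <> 0 &
    match C with
    | Vertical _ => False
    | Semicircle q r => is_root Q (q - r%:num) /\ is_root Q (q + r%:num)
    end].

Definition RM_cap (R : realType) (G : geodesic R) (Delta : R) : set R[i] :=
  [set p | exists (Q : bqf) (C : geodesic R),
    [/\ RM_curve Q C, (disc Q)%:~R <= Delta & perpendicular_at C G p]].

(* The cardinality of a finite set, and 0 for an infinite one. *)
Definition npoints (R : realType) (A : set R[i]) : nat := #|` fset_set A|.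

(* Main.v *)
Require Import Defs.
From mathcomp Require Import all_boot all_order all_algebra.
From mathcomp Require Import finmap complex.
From mathcomp Require Import all_classical all_reals all_analysis.
From mathcomp Require Import ring lra zify.
Import Order.TTheory GRing.Theory Num.Theory.
Import numFieldNormedType.Exports.
Local Open Scope classical_set_scope.
Local Open Scope ring_scope.

(* The points of G met perpendicularly by RM curves are parametrized by the
   rationals. The forms whose RM curve is perpendicular to G are the integer
   points of a rational plane, so the primitive ones correspond, up to sign, to
   coprime pairs (m, n) in a basis of a rank two lattice. The basis can be chosen
   so that m > 0 on the forms of positive discriminant; the intersection point
   then only depends on the slope n / m, and the discriminant is m^2 D(n / m)
   for a positive function D on the arc. It remains to count the coprime pairs
   with slope in an interval and m^2 D(n / m) <= Delta: their number is
   asymptotic to c Delta times the integral of 1 / D, and d(slope) / D is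
   proportional to ds_hyp. When D is constant, all pairs are counted row by row
   and coprimality is imposed by sieving out the gcd; a continuous D is then
   squeezed between constants on short intervals. *)

(** * Sieving out the gcd *)

(** Perpendicularity is linear in (a, b, c). For [Vertical x] it reads b = -2 a x; for
    [Semicircle q r] the Pythagorean relation (q' - q)^2 = r^2 + r'^2 between centers and radii
    becomes c + b q + a (q^2 - r^2) = 0. Rationality of G makes this plane rational, hence its
    integral forms a lattice of rank two. The density of coprime pairs is never evaluated: a single
    constant serves all arcs of G, so the ratio of two counts only needs it to be positive. Moebius
    inversion is avoided as well: the error h of the primitive count satisfies sum_d h(t / d) =
    o(t^2), and because sum_(d >= 2) 1 / d^2 < 1 this already forces h(t) = o(t^2). On a semicircle
    the plane also contains the form with a = 0 whose geodesic is the vertical line over q. It is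
    not an RM curve, so the top of the semicircle is removed, at the cost of one point in the
    count. *)

Lemma sum_inv_sqr_le (R : realFieldType) (n : nat) :
  \sum_(2 <= d < n.+2) (d%:R ^- 2) <= 2 / 3 :> R.
Proof.
(* Telescoping by 1 / d^2 <= 1 / (d - 1/2) - 1 / (d + 1/2). The coarser bound 1 / (d (d - 1)) sums
   to 1, which would give no contraction. *)
suff : \sum_(2 <= d < n.+2) (d%:R ^- 2) <= 2 / 3 - 2 / (2 * n%:R + 3) :> R.
  move/le_trans; apply; rewrite gerBl divr_ge0// addr_ge0// mulr_ge0//.
elim: n => [|n IH]; first by rewrite big_geq// mulr0 add0r subrr.
rewrite big_nat_recr//= -[n.+1%:R]natr1 -[n.+2%:R]natr1 -[n.+1%:R]natr1 -addrA.
have n0 : 0 <= n%:R :> R by [].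
apply: (le_trans (lerD IH (lexx _))).
set x := n%:R in n0 *.
suff : (x + (1 + 1)) ^- 2 <= 2 / (2 * x + 3) - 2 / (2 * (x + 1) + 3) by lra.
have -> : 2 / (2 * x + 3) - 2 / (2 * (x + 1) + 3) =
    4 / ((2 * x + 3) * (2 * x + 5)).
  by field; rewrite !gt_eqF//=; lra.
rewrite ler_pdivlMr; last by nra.
rewrite mulrC ler_pdivrMr; last by nra.
nra.
Qed.

Lemma near_sqr_dominates (R : realType) (A e : R) : 0 < e ->
  \forall t \near +oo, A * t <= e * t ^+ 2.
Proof.
move=> e0; near=> t.
have t0 : 0 < t by near: t; exact: nbhs_pinfty_gt.
rewrite expr2 mulrA ler_pM2r// -ler_pdivrMl//.
Unshelve. all: by end_near. Qed.

Section divisor_sum.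
Variables (R : realType) (h : R -> R) (C : R).

Hypothesis h_le : forall t, 0 <= t -> `|h t| <= C * t ^+ 2.
Hypothesis h_sum : forall e, 0 < e -> \forall t \near +oo,
  `|\sum_(1 <= d < (Num.truncn t).+1) h (t / d%:R)| <= e * t ^+ 2.

(* Isolating the term d = 1, the others contribute at most
   sum_(d >= 2) 1 / d^2 <= 2/3 times the current bound. *)
Lemma divisor_sum_contraction (L e : R) : 0 <= L -> 0 < e ->
  (\forall t \near +oo, `|h t| <= L * t ^+ 2) ->
  \forall t \near +oo, `|h t| <= (2 / 3 * L + e) * t ^+ 2.
Proof.
move=> L0 e0 [M [_ hM]].
have C0 : 0 <= C by have := h_le 1 ler01; rewrite expr1n mulr1; exact: le_trans.
have e2 : 0 < e / 2 by rewrite divr_gt0.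
near=> t.
have t1 : 1 <= t by near: t; exact: nbhs_pinfty_ge.
have t0 : 0 < t by exact: lt_le_trans t1.
have hS : `|\sum_(1 <= d < (Num.truncn t).+1) h (t / d%:R)| <= e / 2 * t ^+ 2.
  by near: t; exact: h_sum.
have hA : C * M ^+ 2 * t <= e / 2 * t ^+ 2.
  by near: t; exact: near_sqr_dominates.
set N := Num.truncn t in hS *.
have N0 : (0 < N)%N by rewrite truncn_gt0.
have Nt : N%:R <= t by rewrite truncn_le ltW.
(* The arguments t / d below the threshold M only obey the bound by C; each contributes at most C
   M^2, and there are at most t of them, so together they are o(t^2). *)
have hbd u : 0 <= u -> `|h u| <= L * u ^+ 2 + C * M ^+ 2.
  move=> u0; have [Mu|uM] := ltP M u.
    by apply: (le_trans (hM _ Mu)); rewrite lerDl mulr_ge0// sqr_ge0.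
  apply: (le_trans (h_le _ u0)); rewrite -[leLHS]add0r lerD//.
    by rewrite mulr_ge0// sqr_ge0.
  by rewrite ler_wpM2l// lerXn2r// ?nnegrE// (le_trans u0).
have hT : `|\sum_(2 <= d < N.+1) h (t / d%:R)| <=
    2 / 3 * L * t ^+ 2 + C * M ^+ 2 * t.
  apply: (le_trans (ler_norm_sum _ _ _)).
  have : \sum_(2 <= d < N.+1) `|h (t / d%:R)| <=
      \sum_(2 <= d < N.+1) (L * t ^+ 2 * d%:R ^- 2 + C * M ^+ 2).
    apply: ler_sum => d _; apply: (le_trans (hbd _ _)).
      by rewrite divr_ge0// ltW.
    by rewrite expr_div_n mulrA.
  move/le_trans; apply.
  rewrite big_split/= -mulr_sumr sumr_const_nat lerD//.
    rewrite -[2 / 3 * _ * _]mulrA [leRHS]mulrC.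
    apply: ler_wpM2l; first by rewrite mulr_ge0// sqr_ge0.
    case: (N) N0 => // k _; exact: sum_inv_sqr_le.
  rewrite -mulr_natr ler_wpM2l ?(mulr_ge0 C0 (sqr_ge0 _))//.
  by apply: le_trans Nt; rewrite ler_nat subSS leq_subr.
move: hS; rewrite big_ltn// divr1 => hS.
have := ler_normB (h t + \sum_(2 <= d < N.+1) h (t / d%:R))
   (\sum_(2 <= d < N.+1) h (t / d%:R)).
rewrite addrK => /le_trans; apply.
apply: (le_trans (lerD hS hT)).
by lra.
Unshelve. all: by end_near. Qed.

(** Iterating the contraction from the a priori constant C makes the constant decay geometrically.
    The start C + 1 is positive even if C = 0. *)
Lemma little_o_of_divisor_sum (e : R) : 0 < e ->
  \forall t \near +oo, `|h t| <= e * t ^+ 2.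
Proof.
move=> e0.
have C0 : 0 <= C by have := h_le 1 ler01; rewrite expr1n mulr1; exact: le_trans.
have hk k : \forall t \near +oo, `|h t| <= (C + 1) * (3 / 4) ^+ k * t ^+ 2.
  elim: k => [|k IH].
    near=> t; rewrite expr0 mulr1.
    have t0 : 0 <= t by near: t; exact: nbhs_pinfty_ge.
    by apply: (le_trans (h_le _ t0)); rewrite ler_wpM2r ?sqr_ge0// lerDl.
  have L0 : 0 < (C + 1) * (3 / 4) ^+ k.
    by rewrite mulr_gt0 ?exprn_gt0 ?divr_gt0// ltr_wpDl.
  (* The slack L / 12 is chosen so that 2/3 + 1/12 = 3/4. *)
  have := @divisor_sum_contraction _ ((C + 1) * (3 / 4) ^+ k / 12) (ltW L0) _ IH.
  rewrite exprS divr_gt0// => /(_ isT); apply: filterS => t /le_trans; apply.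
  by rewrite ler_wpM2r ?sqr_ge0//; lra.
have : (fun k => (C + 1) * (3 / 4 : R) ^+ k) @ \oo --> (C + 1) * 0.
  by apply: cvgM; [exact: cvg_cst|apply: cvg_expr; rewrite ger0_norm; lra].
rewrite mulr0 => /cvgr_lt/(_ _ e0)[k _ /(_ k (leqnn k))] /= ke.
apply: filterS (hk k) => t /le_trans; apply.
by rewrite ler_wpM2r ?sqr_ge0// ltW.
Unshelve. all: by end_near. Qed.

End divisor_sum.

(** * Counting coprime pairs in sectors *)

Section counting.
Context {T : choiceType}.
Implicit Types A B S : set T.

(** [npoints] over any choice type. Infinite sets get 0, so finiteness has to be carried along with
    every count. *)
Definition ncard S : nat := #|` fset_set S|.

Lemma ncard_le A B : finite_set B -> A `<=` B -> (ncard A <= ncard B)%N.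
Proof.
move=> fB AB; have fA := sub_finite_set AB fB.
by apply: fsubset_leq_card; rewrite -fset_set_sub.
Qed.

Lemma ncard_setU A B : finite_set A -> finite_set B -> A `&` B = set0 ->
  ncard (A `|` B) = (ncard A + ncard B)%N.
Proof.
move=> fA fB AB; rewrite /ncard fset_setU// cardfsU -fset_setI// AB.
by rewrite fset_set0 cardfs0 subn0.
Qed.

Lemma ncard_set1 (x : T) : ncard [set x] = 1%N.
Proof. by rewrite /ncard fset_set1 cardfs1. Qed.

Lemma ncard_set0 : ncard (@set0 T) = 0%N.
Proof. by rewrite /ncard fset_set0 cardfs0. Qed.

Lemma ncard_fibers S (g : T -> nat) N : finite_set S ->
  (forall x, S x -> (g x < N)%N) ->
  ncard S = (\sum_(0 <= i < N) ncard (S `&` [set x | g x = i]))%N.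
Proof.
elim: N S => [|N IH] S fS Sg.
  rewrite big_geq// (_ : S = set0) ?ncard_set0//.
  by apply/seteqP; split => x // /Sg.
rewrite big_nat_recr//=.
have <- : (S `&` [set x | (g x < N)%N]) `|` (S `&` [set x | g x = N]) = S.
  apply/seteqP; split => x /=; first by move=> [[]|[]].
  move=> Sx; have := Sg _ Sx; rewrite ltnS leq_eqVlt => /orP[/eqP ->|gN].
    by right.
  by left.
rewrite ncard_setU; [|exact: finite_setIl|exact: finite_setIl|]; last first.
  apply/seteqP; split => x //= -[[_ +] [_ gN]]; by rewrite gN ltnn.
rewrite (IH (S `&` [set x | (g x < N)%N])); last 2 first.
- exact: finite_setIl.
- by move=> x [].
congr (_ + _)%N.
  apply: eq_big_nat => i /andP[_ iN]; congr ncard.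
  apply/seteqP; split => x /= -[].
    by move=> [Sx gx] gi; split => //; left.
  by move=> [[Sx gx]|[Sx gx]] gi; split => //; split => //; lia.
congr ncard.
apply/seteqP; split => x /= -[].
  by move=> Sx gi; split => //; right.
by move=> [[Sx gx]|[Sx gx]] gi; split => //; split => //; lia.
Qed.

End counting.

Lemma ncard_image {T U : choiceType} (f : T -> U) (S : set T) :
  finite_set S -> {in S &, injective f} -> ncard (f @` S) = ncard S.
Proof.
move=> /finite_setP[n Sn] fI; rewrite /ncard (card_fset_set Sn).
by apply: card_fset_set; exact: card_eq_trans (inj_card_eq fI) Sn.
Qed.

Definition int_itv {R : realType} (x y : R) : set int :=
  [set n | x <= n%:~R < y].

Lemma int_itv_image {R : realType} (x y : R) : x <= y ->
  int_itv x y =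
  (fun i : nat => Num.ceil x + i%:Z) @` `I_(`|Num.ceil y - Num.ceil x|)%N.
Proof.
move=> xy; have cxy := le_ceil xy.
apply/seteqP; split => n /=.
  rewrite /int_itv/= -ceil_le_int -ceil_gt_int.
  move: (Num.ceil x) (Num.ceil y) cxy => cx cy cxy /andP[xn ny].
  by exists `|n - cx|%N => /=; lia.
move=> [i /= iN <-].
rewrite /int_itv/= -ceil_le_int -ceil_gt_int.
by move: (Num.ceil x) (Num.ceil y) cxy iN => cx cy cxy iN; lia.
Qed.

Lemma finite_int_itv {R : realType} (x y : R) :
  finite_set (int_itv x y).
Proof.
have [xy|yx] := leP x y; first by rewrite int_itv_image//; exact: finite_image.
rewrite (_ : int_itv x y = set0 :> set int)//; apply/seteqP; split => n //= /andP[xn ny].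
by have := le_lt_trans xn (lt_trans ny yx); rewrite ltxx.
Qed.

Lemma ncard_int_itv {R : realType} (x y : R) : x <= y ->
  `|(ncard (int_itv x y))%:R - (y - x)| <= 1.
Proof.
move=> xy; have cxy := le_ceil xy.
rewrite int_itv_image// ncard_image//; last by move=> i j _ _ /addrI[].
rewrite /ncard (@card_fset_set _ _ `|Num.ceil y - Num.ceil x|%N) ?card_eqxx//.
have -> : `|Num.ceil y - Num.ceil x|%N%:R =
    (Num.ceil y)%:~R - (Num.ceil x)%:~R :> R.
  by rewrite -intrB natr_absz ger0_norm// subr_ge0.
have /andP[] := ceil_itv x; have /andP[] := ceil_itv y; rewrite !intrB.
by rewrite ler_norml; lra.
Qed.

Section sector.
Variable R : realType.
Implicit Types a b t : R.

Definition sector a b t : set (nat * int) :=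
  [set p | [/\ (0 < p.1)%N, p.1%:R <= t &
               a * p.1%:R <= p.2%:~R < b * p.1%:R]].

Definition prim : set (nat * int) := [set p | coprime p.1 `|p.2|%N].

Lemma finite_sector a b t : finite_set (sector a b t).
Proof.
have -> : sector a b t = sector a b t `&`
    \bigcup_(m in `I_(Num.truncn t).+1)
      (fun n => (m, n)) @` int_itv (a * m%:R)%R (b * m%:R)%R.
  apply/esym/setIidl => -[m n] [/= m0 mt mn]; exists m => /=; last by exists n.
  by rewrite ltnS truncn_ge_nat// (le_trans _ mt).
apply: finite_setIr; apply: bigcup_finite; first exact: finite_II.
by move=> m _; apply: finite_image; exact: finite_int_itv.
Qed.

Lemma ncard_sectorE a b t : ncard (sector a b t) =
  (\sum_(1 <= m < (Num.truncn t).+1)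
     ncard (int_itv (a * m%:R)%R (b * m%:R)%R))%N.
Proof.
have [t1|t1] := ltP t 1.
  have -> : sector a b t = set0.
    apply/seteqP; split => -[m n] // [/= m0 mt _].
    by have := le_lt_trans mt t1; rewrite ltrn1; lia.
  by rewrite ncard_set0 big_geq// ltnS leqNgt truncn_gt0 -ltNge.
rewrite (@ncard_fibers _ _ fst (Num.truncn t).+1); last 2 first.
- exact: finite_sector.
- move=> [m n] [/= m0 mt _]; rewrite ltnS truncn_ge_nat//.
  exact: le_trans ler01 t1.
rewrite big_ltn// (_ : _ `&` _ = set0) ?ncard_set0 ?add0n; last first.
  by apply/seteqP; split => -[m n] //= [[/= m0 _ _] me]; rewrite me in m0.
apply: eq_big_nat => m /andP[m0 mt].
rewrite -[RHS](@ncard_image _ _ (fun n => (m, n))); last 2 first.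
- exact: finite_int_itv.
- by move=> n n' _ _ [].
congr ncard; apply/seteqP; split => -[k n] /=.
  by move=> [[/= k0 kt kn] <-]; exists n.
move=> [n' nn' [<- <-]]; split => //; split => //=.
by rewrite -truncn_ge_nat// (le_trans ler01).
Qed.

(** Row m holds (b - a) m points up to an error of 1. Summing over m <= N gives (b - a) / 2 times N
    (N + 1), and N (N + 1) lies between t^2 - t and t^2 + t. *)
Lemma ncard_sector_approx a b t : a <= b -> 0 <= t ->
  `|(ncard (sector a b t))%:R - (b - a) / 2 * t ^+ 2| <= ((b - a) / 2 + 1) * t.
Proof.
move=> ab t0; rewrite ncard_sectorE.
have /andP[] := truncn_itv t0; set N := Num.truncn t => Nt tN.
have ba : 0 <= b - a by rewrite subr_ge0.
have : `|(\sum_(1 <= m < N.+1)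
     ncard (int_itv (a * m%:R)%R (b * m%:R)%R))%N%:R
    - (b - a) / 2 * (N%:R * (N%:R + 1))| <= N%:R.
  elim: (N) => [|n IH]; first by rewrite big_geq// mul0r mulr0 subrr normr0.
  rewrite big_nat_recr//= natrD -[n.+1%:R]natr1.
  have le : a * n.+1%:R <= b * n.+1%:R by rewrite ler_wpM2r.
  have := ncard_int_itv _ _ le; rewrite -[n.+1%:R]natr1.
  move: IH; rewrite !ler_norml; set x := n%:R; lra.
rewrite -[in N.+1%:R]addn1 natrD in tN.
move: (_%:R) => F; move: N%:R Nt tN => n Nt tN.
rewrite !ler_norml => /andP[h1 h2].
have k1 : (b - a) / 2 * (n * (n + 1)) <= (b - a) / 2 * (t ^+ 2 + t).
  by rewrite ler_wpM2l ?divr_ge0//; nra.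
have k2 : (b - a) / 2 * (t ^+ 2 - t) <= (b - a) / 2 * (n * (n + 1)).
  by rewrite ler_wpM2l ?divr_ge0//; nra.
apply/andP; split; lra.
Qed.

(** Dividing a pair of gcd d by d preserves its slope and turns the bound t into t / d. Since m > 0,
    the gcd lies between 1 and m <= t. *)
Lemma ncard_sector_gcd a b t : 1 <= t -> ncard (sector a b t) =
  (\sum_(1 <= d < (Num.truncn t).+1) ncard (sector a b (t / d%:R) `&` prim))%N.
Proof.
move=> t1; have t0 : 0 <= t by exact: le_trans t1.
rewrite (@ncard_fibers _ _ (fun p => gcdn p.1 `|p.2|%N) (Num.truncn t).+1);
  last 2 first.
- exact: finite_sector.
- move=> [m n] [/= m0 mt _]; rewrite ltnS truncn_ge_nat//.
  by apply: le_trans mt; rewrite ler_nat dvdn_leq// dvdn_gcdl.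
rewrite big_ltn// (_ : _ `&` _ = set0) ?ncard_set0 ?add0n; last first.
  apply/seteqP; split => -[m n] //= [[/= m0 _ _] /eqP].
  by rewrite -leqn0 leqNgt gcdn_gt0 m0.
apply: eq_big_nat => d /andP[d0 dt].
have d0R : 0 < d%:R :> R by rewrite ltr0n.
rewrite -[RHS](@ncard_image _ _ (fun p : nat * int => ((d * p.1)%N, d%:Z * p.2)));
  last 2 first.
- by apply: finite_setIl; exact: finite_sector.
- move=> [m n] [m' n'] _ _ [/eqP + /eqP].
  by rewrite eqn_pmul2l// => /eqP -> /eqP/mulfI -> //; lia.
congr ncard; apply/seteqP; split => -[m n] /=.
- move=> [[/= m0 mt mn] g].
  have /dvdnP[m' m'E] : (d %| m)%N by rewrite -g dvdn_gcdl.
  have /dvdzP[n' n'E] : (d%:Z %| n)%Z by rewrite -g dvdzE dvdn_gcdr.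
  rewrite mulnC in m'E; rewrite mulrC in n'E; subst m n.
  exists (m', n') => //; split.
    split => /=; first by move: m0; rewrite muln_gt0 => /andP[].
      by rewrite ler_pdivlMr// -natrM mulnC.
    move: mn; rewrite natrM intrM [a * _]mulrCA [b * _]mulrCA.
    by rewrite -pmulrn ler_pM2l// ltr_pM2l.
  move: g; rewrite /prim/= abszM -muln_gcdr -[in RHS](muln1 d) => /eqP.
  by rewrite eqn_pmul2l.
- move=> [[m' n'] [[/= m0 mt mn] g] [<- <-]]; split; last first.
    by rewrite abszM -muln_gcdr; move/eqP: g => ->; rewrite muln1.
  split => /=; first by rewrite muln_gt0 d0.
    by move: mt; rewrite ler_pdivlMr// -natrM mulnC.
  rewrite natrM intrM [a * _]mulrCA [b * _]mulrCA.
  by rewrite -pmulrn ler_pM2l// ltr_pM2l.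
Qed.

Lemma cvg_sum_inv_sqr : exists2 z : R, 0 < z &
  (fun n => \sum_(1 <= d < n.+1) d%:R ^- 2) @ \oo --> z.
Proof.
pose u (n : nat) : R := \sum_(1 <= d < n.+1) d%:R ^- 2.
have u_nd : nondecreasing_seq u.
  apply/nondecreasing_seqP => n; rewrite /u [leRHS]big_nat_recr//= lerDl.
  by rewrite invr_ge0 sqr_ge0.
have u_cvg : cvgn u.
  apply: nondecreasing_is_cvgn => //; exists (1 + 2 / 3) => _ [n _ <-].
  rewrite (le_trans (u_nd n n.+1 _))// /u big_ltn// expr1n invr1.
  by rewrite lerD// sum_inv_sqr_le.
exists (limn u) => //.
apply: lt_le_trans (@nondecreasing_cvgn_le _ _ u_nd u_cvg 1%N).
by rewrite /u big_nat1 expr1n invr1.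
Qed.

(* The constant is c = 1 / (2 zeta(2)) = 3 / pi^2, whose value is irrelevant. *)
Lemma ncard_prim_sector : exists2 c : R, 0 < c &
  forall a b, a <= b -> forall e, 0 < e -> \forall t \near +oo,
  `|(ncard (sector a b t `&` prim))%:R - c * (b - a) * t ^+ 2| <= e * t ^+ 2.
Proof.
have [z z0 uz] := cvg_sum_inv_sqr.
have c0 : 0 < (2 * z)^-1 by rewrite invr_gt0 mulr_gt0.
exists (2 * z)^-1 => // a b ab; set c := _^-1 in c0 *.
have ba : 0 <= b - a by rewrite subr_ge0.
have cba : 0 <= c * (b - a) by rewrite mulr_ge0// ltW.
pose f t : R := (ncard (sector a b t `&` prim))%:R.
(* The linear error of the sector count is absorbed into t^2 only for t >= 1. The divisor sums
   evaluate h only at t / d >= 1, so the cut-off does not affect them. *)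
pose h t : R := if 1 <= t then f t - c * (b - a) * t ^+ 2 else 0.
have h_le t : 0 <= t -> `|h t| <= ((b - a) + 1 + c * (b - a)) * t ^+ 2.
  move=> t0; rewrite /h; case: ifP => [t1|_]; last first.
    by rewrite normr0 mulr_ge0 ?sqr_ge0// addr_ge0// addr_ge0.
  have := ncard_sector_approx _ _ _ ab t0.
  have f0 : 0 <= f t by rewrite ler0n.
  have : f t <= (ncard (sector a b t))%:R.
    by rewrite ler_nat; apply: ncard_le; [exact: finite_sector|exact: subIsetl].
  have h1 : ((b - a) / 2 + 1) * t <= ((b - a) / 2 + 1) * t ^+ 2.
    by rewrite ler_wpM2l ?addr_ge0 ?divr_ge0//; nra.
  have h2 : 0 <= c * (b - a) * t ^+ 2 by rewrite mulr_ge0// sqr_ge0.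
  have h3 : 0 <= (b - a + 1) * t ^+ 2 by rewrite mulr_ge0 ?sqr_ge0// addr_ge0.
  rewrite !ler_norml => h4 /andP[h5 h6]; apply/andP; split; lra.
have h_sum e : 0 < e -> \forall t \near +oo,
    `|\sum_(1 <= d < (Num.truncn t).+1) h (t / d%:R)| <= e * t ^+ 2.
  move=> e0; set A := (b - a) / 2 + 1.
  (* The added 1 avoids division by zero when a = b. *)
  have d0 : 0 < e / 2 / (c * (b - a) + 1).
    by rewrite divr_gt0 ?divr_gt0// ltr_wpDl.
  have /cvgrPdist_le/(_ _ d0)[M _ /= hM] := uz.
  have e2 : 0 < e / 2 by rewrite divr_gt0.
  near=> t.
  have At : A * t <= e / 2 * t ^+ 2 by near: t; exact: near_sqr_dominates.
  have t1 : 1 <= t by near: t; exact: nbhs_pinfty_ge.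
  have Mt : M%:R <= t by near: t; exact: nbhs_pinfty_ge.
  have t0 : 0 <= t by exact: le_trans t1.
  have -> : \sum_(1 <= d < (Num.truncn t).+1) h (t / d%:R) =
      (ncard (sector a b t))%:R - c * (b - a) * t ^+ 2 *
      \sum_(1 <= d < (Num.truncn t).+1) d%:R ^- 2.
    rewrite ncard_sector_gcd// natr_sum mulr_sumr -sumrB.
    apply: eq_big_nat => d /andP[d0' dt].
    rewrite /h ler_pdivlMr ?ltr0n// mul1r -truncn_ge_nat// -ltnS dt.
    by rewrite expr_div_n mulrA.
  have {hM} := hM (Num.truncn t); rewrite /= truncn_ge_nat// => /(_ Mt).
  set Z := \sum_(_ <= _ < _) _ => hZ.
  (* As c z = 1/2, the main terms cancel; what remains is the error of the full sector count and the
     tail of the series. *)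
  have hcz : c * (b - a) * z = (b - a) / 2 by rewrite /c; field; lra.
  have hd : c * (b - a) * t ^+ 2 * `|z - Z| <= e / 2 * t ^+ 2.
    rewrite mulrAC ler_wpM2r ?sqr_ge0//.
    apply: (le_trans (ler_wpM2l cba hZ)).
    have -> : c * (b - a) * (e / 2 / (c * (b - a) + 1)) =
        e / 2 * (c * (b - a) / (c * (b - a) + 1)) by ring.
    apply: ler_piMr; first exact: ltW.
    by rewrite ler_pdivrMr ?ltr_wpDl// mul1r lerDl.
  have -> : (ncard (sector a b t))%:R - c * (b - a) * t ^+ 2 * Z =
     ((ncard (sector a b t))%:R - (b - a) / 2 * t ^+ 2) +
     c * (b - a) * t ^+ 2 * (z - Z) by rewrite -hcz; ring.
  apply: (le_trans (ler_normD _ _)).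
  rewrite [X in _ + X]normrM [X in _ + X * _]ger0_norm; last first.
    by rewrite mulr_ge0// sqr_ge0.
  have := ncard_sector_approx _ _ _ ab t0; rewrite -/A; lra.
move=> e e0; have := little_o_of_divisor_sum _ _ _ h_le h_sum _ e0.
move=> hs; near=> t.
have : `|h t| <= e * t ^+ 2 by near: t.
rewrite /h ifT//; near: t; exact: nbhs_pinfty_ge.
Unshelve. all: by end_near. Qed.

End sector.

(** * Counting coprime pairs in star-shaped regions *)

(** Compactness of [a, b] in a form that needs no subdivision: the supremum s of the points y with P
    a y is attained and, by the local property at s, could be passed if s < b. *)
Lemma segment_induction (R : realType) (P : R -> R -> Prop) (a b : R) : a <= b ->
  (forall x y z, a <= x -> x <= y -> y <= z -> z <= b ->
    P x y -> P y z -> P x z) ->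
  (forall x, a <= x <= b -> exists2 d, 0 < d &
    forall u v, a <= u -> x - d < u -> u <= x -> x <= v -> v < x + d -> v <= b ->
    P u v) ->
  P a b.
Proof.
move=> ab Padd Ploc.
pose S := [set y | a <= y <= b /\ P a y].
have Sa : S a.
  split; first by rewrite lexx.
  have [|d d0] := Ploc a; first by rewrite lexx.
  by apply => //; lra.
have Sb : has_sup S by split; [exists a|exists b => y [/andP[]]].
set s := sup S.
have as_ : a <= s by exact: sup_upper_bound.
have sb : s <= b by apply: sup_le_ub; [exists a|move=> y [/andP[]]].
have [|d d0 hd] := Ploc s; first by rewrite as_.
have [y [/andP[ay yb] Pay] sy] := sup_adherent d0 Sb.
have ys : y <= s by apply: sup_upper_bound => //; split => //; rewrite ay.
have Pas : P a s by apply: (Padd a y s) => //; apply: hd => //; lra.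
have [bs|sb'] := leP b s; first by rewrite (le_anti (y := s) (x := b)) // sb bs.
pose v := Num.min b (s + d / 2).
have sv : s < v by rewrite lt_min sb'/=; lra.
have vb : v <= b by rewrite ge_min lexx.
have Pav : P a v.
  apply: (Padd a s v) => //; first exact: ltW.
  apply: hd => //; first lra; first exact: ltW.
  by rewrite gt_min; apply/orP; right; lra.
have : v <= s.
  by apply: sup_upper_bound => //; split => //; rewrite vb (le_trans as_)// ltW.
by rewrite leNgt sv.
Qed.

Section star.
Variable R : realType.
Implicit Types (a b x y z : R) (D : R -> R).

(** At a fixed slope s the last condition is a bound on m alone, m <= sqrt (Delta / D s), so the
    region is star-shaped about the origin. The half-open slope range lets adjacent regions be
    disjoint. *)
Definition star D a b (Delta : R) : set (nat * int) :=
  [set p | [/\ (0 < p.1)%N, prim p, a * p.1%:R <= p.2%:~R < b * p.1%:R &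
    p.1%:R ^+ 2 * D (p.2%:~R / p.1%:R) <= Delta]].

Lemma star_slope a b (p : nat * int) : (0 < p.1)%N ->
  a * p.1%:R <= p.2%:~R < b * p.1%:R -> a <= p.2%:~R / p.1%:R < b.
Proof. by move=> p0; rewrite ler_pdivlMr ?ltr_pdivrMr ?ltr0n. Qed.

Lemma star_cat D x y z Delta : x <= y -> y <= z ->
  star D x z Delta = star D x y Delta `|` star D y z Delta.
Proof.
move=> xy yz; apply/seteqP; split => -[m n] /=.
  move=> [/= m0 mn /andP[h1 h2] h3].
  have [h|h] := ltP n%:~R (y * m%:R).
    by left; split => //=; rewrite h1.
  by right; split => //=; rewrite h.
have h1 : x * m%:R <= y * m%:R by rewrite ler_wpM2r.
have h2 : y * m%:R <= z * m%:R by rewrite ler_wpM2r.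
by move=> [] [/= m0 mn /andP[h3 h4] h5]; split => //=; apply/andP; split; lra.
Qed.

Lemma star_disjoint D x y z Delta :
  star D x y Delta `&` star D y z Delta = set0.
Proof.
apply/seteqP; split => -[m n] //= [[/= _ _ /andP[_ h] _] [/= _ _ /andP[h' _] _]].
by have := lt_le_trans h h'; rewrite ltxx.
Qed.

(** One half of the squeeze: a lower bound on D encloses the star in a sector. The other half is
    [sector_sub_star]. *)
Lemma star_sub_sector D a b Delta k : 0 < k ->
  (forall s, a <= s < b -> k <= D s) ->
  star D a b Delta `<=` sector R a b (Num.sqrt (Delta / k)) `&` prim.
Proof.
move=> k0 kD [m n] [/= m0 mn h1 h2]; split => //; split => //=.
have mD : m%:R ^+ 2 * k <= Delta.
  apply: le_trans h2; rewrite ler_wpM2l ?sqr_ge0// kD//.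
  exact: (star_slope _ _ (m, n)).
have Dk : 0 <= Delta / k.
  rewrite divr_ge0 ?(ltW k0)//.
  by apply: le_trans mD; rewrite mulr_ge0 ?sqr_ge0// ltW.
rewrite -(@ler_pXn2r _ 2)// ?nnegrE ?sqrtr_ge0//.
by rewrite sqr_sqrtr// ler_pdivlMr.
Qed.

Lemma sector_sub_star D a b Delta k : 0 < k -> 0 <= Delta ->
  (forall s, a <= s < b -> D s <= k) ->
  sector R a b (Num.sqrt (Delta / k)) `&` prim `<=` star D a b Delta.
Proof.
move=> k0 Delta0 kD [m n] [[/= m0 h1 h2] mn]; split => //=.
have mD : m%:R ^+ 2 <= Delta / k.
  rewrite -[leRHS]sqr_sqrtr; last by rewrite divr_ge0// ltW.
  by rewrite ler_pXn2r ?nnegrE ?sqrtr_ge0//.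
rewrite ler_pdivlMr// in mD; apply: le_trans mD.
by rewrite ler_wpM2l ?sqr_ge0// kD//; exact: (star_slope _ _ (m, n)).
Qed.

Lemma near_sqrt_div (P : R -> Prop) k : 0 < k ->
  (\forall t \near +oo, P t) -> \forall Delta \near +oo, P (Num.sqrt (Delta / k)).
Proof.
move=> k0 [M [_ hM]]; near=> Delta.
have h : (`|M| + 1) ^+ 2 * k <= Delta.
  by near: Delta; apply: nbhs_pinfty_ge; exact: num_real.
apply: hM; apply: (@lt_le_trans _ _ (`|M| + 1)).
  by apply: (le_lt_trans (ler_norm _)); rewrite ltrDl.
have Dk : 0 <= Delta / k.
  by rewrite divr_ge0 ?(ltW k0)//.
rewrite -(@ler_pXn2r _ 2)// ?nnegrE ?sqrtr_ge0 ?addr_ge0//.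
by rewrite sqr_sqrtr// ler_pdivlMr.
Unshelve. all: by end_near. Qed.

(** W is an antiderivative of 1 / D, so W b - W a is the integral. The constant c is quantified
    before D, W and the interval, so that it can cancel in a ratio. *)
Lemma ncard_star : exists2 c : R, 0 < c &
  forall D W a b, a <= b ->
  (forall x, a <= x <= b -> 0 < D x) ->
  (forall x, a <= x <= b -> {for x, continuous D}) ->
  (forall x, a <= x <= b -> is_derive x 1 W (D x)^-1) ->
  (forall Delta, finite_set (star D a b Delta)) /\
  forall e, 0 < e -> \forall Delta \near +oo,
    `|(ncard (star D a b Delta))%:R - c * (W b - W a) * Delta| <= e * Delta.
Proof.
have [c c0 hc] := ncard_prim_sector R.
exists c => // D W a b ab D0 Dc WD.
have hq q u v e : u <= v -> 0 < q -> 0 < e -> \forall Delta \near +oo,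
    `|(ncard (sector R u v (Num.sqrt (Delta / q)) `&` prim))%:R
      - c * (v - u) / q * Delta| <= e * Delta.
  move=> uv q0 e0; have eq0 : 0 < e * q by rewrite mulr_gt0.
  have h := near_sqrt_div _ _ q0 (hc u v uv _ eq0); near=> Delta.
  have Delta0 : 0 <= Delta by near: Delta; exact: nbhs_pinfty_ge.
  have : `|(ncard (sector R u v (Num.sqrt (Delta / q)) `&` prim))%:R
      - c * (v - u) * Num.sqrt (Delta / q) ^+ 2|
      <= e * q * Num.sqrt (Delta / q) ^+ 2 by near: Delta.
  rewrite sqr_sqrtr; last exact: divr_ge0 Delta0 (ltW q0).
  by congr (`|_ - _| <= _); field; lra.
have mvt u v : a <= u -> u <= v -> v <= b ->
    exists2 x, u <= x <= v & W v - W u = (D x)^-1 * (v - u).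
  move=> au uv vb.
  have [x||x xuv ->] := @MVT_segment _ W (fun x => (D x)^-1) u v uv.
  - by rewrite in_itv/= => /andP[ux xv]; apply: WD; apply/andP; split; lra.
  - apply: derivable_within_continuous => x; rewrite in_itv/= => /andP[ux xv].
    by have [|] := WD x; first by apply/andP; split; lra.
  - by exists x.
(* An error proportional to b - a is additive under concatenation, which is what [segment_induction]
   requires. *)
have main e : 0 < e -> (forall Delta, finite_set (star D a b Delta)) /\
    \forall Delta \near +oo,
    `|(ncard (star D a b Delta))%:R - c * (W b - W a) * Delta| <=
      e * (b - a) * Delta.
  move=> e0.
  apply: (segment_induction _ (fun a b => (forall Delta, finite_set (star D a b Delta)) /\
    \forall Delta \near +oo,
    `|(ncard (star D a b Delta))%:R - c * (W b - W a) * Delta| <=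
      e * (b - a) * Delta) a b ab).
    move=> x y z ax xy yz zb [f1 h1] [f2 h2]; split.
      by move=> Delta; rewrite (star_cat _ _ y)// finite_setU.
    near=> Delta.
    rewrite (star_cat _ _ y)// ncard_setU ?star_disjoint// natrD.
    have H1 : `|(ncard (star D x y Delta))%:R - c * (W y - W x) * Delta| <=
      e * (y - x) * Delta by near: Delta.
    have H2 : `|(ncard (star D y z Delta))%:R - c * (W z - W y) * Delta| <=
      e * (z - y) * Delta by near: Delta.
    have -> : e * (z - x) * Delta = e * (y - x) * Delta + e * (z - y) * Delta.
      by ring.
    apply: le_trans (lerD H1 H2); apply: le_trans (ler_normD _ _).
    by rewrite le_eqVlt; apply/orP; left; apply/eqP; congr `|_|; ring.
  move=> x axb; set k := c / D x.
  have Dx0 := D0 x axb.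
  have k0 : 0 < k by rewrite divr_gt0.
  (* k / 2 keeps k - e' positive; e / 4 fits the budget, the total error being at most 2 e' (v - u)
     + e1 with e1 = e / 4 (v - u). *)
  pose e' := Num.min (e / 4) (k / 2).
  have e'0 : 0 < e' by rewrite lt_min !divr_gt0.
  have e'e : e' <= e / 4 by rewrite ge_min lexx.
  have e'k : e' <= k / 2 by rewrite ge_min lexx orbT.
  have cD : {for x, continuous (fun y => c / D y)}.
    apply: cvgM; first exact: cvg_cst.
    by apply: cvgV; [rewrite gt_eqF|exact: Dc].
  have /cvgrPdist_le/(_ _ e'0)[/= d d0 hd] := cD.
  exists d => // u v au xu ux xv vx vb.
  have Dbd s : u <= s <= v -> k - e' <= c / D s <= k + e'.
    move=> /andP[us sv]; have := hd s; rewrite /ball/= -/k => /(_ _)/=.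
    rewrite ltr_norml ler_norml => /(_ _)/andP[].
      by apply/andP; split; lra.
    by move=> h1 h2; apply/andP; split; lra.
  have ke1 : 0 < k - e' by lra.
  have ke2 : 0 < k + e' by lra.
  have Dlo s : u <= s < v -> c / (k + e') <= D s.
    move=> /andP[us sv].
    have Ds : 0 < D s by apply: D0; apply/andP; split; lra.
    have /andP[_] : k - e' <= c / D s <= k + e' by apply: Dbd; rewrite us ltW.
    by rewrite !ler_pdivrMr// mulrC.
  have Dhi s : u <= s < v -> D s <= c / (k - e').
    move=> /andP[us sv].
    have Ds : 0 < D s by apply: D0; apply/andP; split; lra.
    have /andP[+ _] : k - e' <= c / D s <= k + e' by apply: Dbd; rewrite us ltW.
    by rewrite !ler_pdivlMr// mulrC.
  have cm0 : 0 < c / (k + e') by rewrite divr_gt0.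
  have cM0 : 0 < c / (k - e') by rewrite divr_gt0.
  have fin Delta : finite_set (star D u v Delta).
    apply: sub_finite_set (star_sub_sector _ _ _ _ _ cm0 Dlo) _.
    by apply: finite_setIl; exact: finite_sector.
  split => //.
  have uv : u <= v by exact: le_trans xv.
  (* Treated apart because the tolerance e1 below vanishes when u = v. *)
  have [->|neq] := eqVneq u v.
    near=> Delta.
    rewrite (_ : star _ _ _ _ = set0); last first.
      apply/seteqP; split => p // [_ _ /andP[h h'] _].
      by have := le_lt_trans h h'; rewrite ltxx.
    by rewrite ncard_set0 !subrr !mulr0 !mul0r subrr normr0.
  have vu : 0 < v - u by rewrite subr_gt0 lt_neqAle neq.
  pose e1 := e / 4 * (v - u).
  have e10 : 0 < e1 by rewrite mulr_gt0 ?divr_gt0.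
  (* By the mean value theorem c (W v - W u) lies between (k - e') (v - u) and (k + e') (v - u), the
     densities of the inner and outer sectors. *)
  have [s usv Ws] := mvt u v au uv vb.
  have /andP[W1 W2] := Dbd s usv.
  have cW : c * (W v - W u) = c / D s * (v - u) by rewrite Ws mulrA.
  have W1' : (k - e') * (v - u) <= c * (W v - W u).
    by rewrite cW ler_wpM2r// ltW.
  have W2' : c * (W v - W u) <= (k + e') * (v - u).
    by rewrite cW ler_wpM2r// ltW.
  have := hq _ u v e1 uv cm0 e10; have := hq _ u v e1 uv cM0 e10.
  have -> : c * (v - u) / (c / (k + e')) = (k + e') * (v - u) by field; lra.
  have -> : c * (v - u) / (c / (k - e')) = (k - e') * (v - u) by field; lra.
  move=> hM hm; near=> Delta.
  have Delta0 : 0 <= Delta by near: Delta; exact: nbhs_pinfty_ge.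
  have : `|(ncard (sector R u v (Num.sqrt (Delta / (c / (k + e')))) `&` prim))%:R
      - (k + e') * (v - u) * Delta| <= e1 * Delta by near: Delta.
  have : `|(ncard (sector R u v (Num.sqrt (Delta / (c / (k - e')))) `&` prim))%:R
      - (k - e') * (v - u) * Delta| <= e1 * Delta by near: Delta.
  have : ((ncard (sector R u v (Num.sqrt (Delta / (c / (k - e')))) `&` prim))%:R : R)
      <= (ncard (star D u v Delta))%:R.
    by rewrite ler_nat; apply: ncard_le => //; exact: sector_sub_star.
  have : (ncard (star D u v Delta))%:R <=
      ((ncard (sector R u v (Num.sqrt (Delta / (c / (k + e')))) `&` prim))%:R : R).
    rewrite ler_nat; apply: ncard_le.
      by apply: finite_setIl; exact: finite_sector.
    exact: star_sub_sector.
  have V1 := ler_wpM2r Delta0 W1'.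
  have V2 := ler_wpM2r Delta0 W2'.
  have E1 : e1 * Delta = e / 4 * ((v - u) * Delta) by rewrite /e1 mulrA.
  have E2 : e' * ((v - u) * Delta) <= e / 4 * ((v - u) * Delta).
    by rewrite ler_wpM2r// mulr_ge0// ltW.
  have E3 : e * (v - u) * Delta = e * ((v - u) * Delta) by rewrite mulrA.
  rewrite E1 E3.
  have E4 : (k + e') * (v - u) * Delta =
    k * ((v - u) * Delta) + e' * ((v - u) * Delta) by ring.
  have E5 : (k - e') * (v - u) * Delta =
    k * ((v - u) * Delta) - e' * ((v - u) * Delta) by ring.
  rewrite E4 in V2 *; rewrite E5 in V1 *.
  move=> g1 g2; rewrite !ler_norml => /andP[q1 q2] /andP[q3 q4].
  apply/andP; split; lra.
split; first by have [] := main 1 ltr01.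
move=> e e0; have d0 : 0 < e / (b - a + 1) by rewrite divr_gt0// ltr_wpDl// subr_ge0.
have [_ h] := main _ d0; near=> Delta.
have Delta0 : 0 <= Delta by near: Delta; exact: nbhs_pinfty_ge.
have H : `|(ncard (star D a b Delta))%:R - c * (W b - W a) * Delta| <=
  e / (b - a + 1) * (b - a) * Delta by near: Delta.
apply: (le_trans H); rewrite ler_wpM2r//.
by rewrite mulrAC ler_pdivrMr ?ltr_wpDl ?subr_ge0// ler_wpM2l// ?ltW//; lra.
Unshelve. all: by end_near. Qed.

End star.

(** * From coprime pairs to their slopes *)

Lemma coprime_ratio_inj (R : realFieldType) (p q : nat * int) :
  (0 < p.1)%N -> (0 < q.1)%N -> prim p -> prim q ->
  p.2%:~R / p.1%:R = q.2%:~R / q.1%:R :> R -> p = q.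
Proof.
case: p q => [m n] [m' n'] /= m0 m'0 mn mn' /eqP.
rewrite eqr_div ?pnatr_eq0 -?lt0n// -![_%:R]/(_%:Z%:~R) -!intrM eqr_int.
move=> /eqP e; have := congr1 absz e; rewrite !abszM /= => ae.
have mm' : (m %| m')%N.
  by rewrite -(@Gauss_dvdr _ `|n|)// ae dvdn_mull.
have m'm : (m' %| m)%N.
  by rewrite -(@Gauss_dvdr _ `|n'|)// -ae dvdn_mull.
have mE : m = m' by apply/eqP; rewrite eqn_dvd mm'.
rewrite -{}mE in m'0 e *; congr pair; apply: mulIf e.
by rewrite eqz_nat -lt0n.
Qed.

Section slopes.
Variable R : realType.
Implicit Types (a b : R) (D : R -> R).

Definition slopes D a b (Delta : R) : set R :=
  [set s | a <= s <= b /\ exists p : nat * int, [/\ (0 < p.1)%N, prim p,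
    s = p.2%:~R / p.1%:R & p.1%:R ^+ 2 * D s <= Delta]].

(* The slopes of [star] fill the half-open interval, so b may be missing. *)
Lemma slopesE D a b Delta : a <= b -> slopes D a b Delta =
  (fun p : nat * int => p.2%:~R / p.1%:R) @` star R D a b Delta `|`
  (slopes D a b Delta `&` [set b]).
Proof.
move=> ab; apply/seteqP; split => s /=.
  move=> sS; have [/andP[as_ sb] [p [p0 pp sE hD]]] := sS.
  have [sb'|bs] := ltP s b; last first.
    by right; split => //; apply/eqP; rewrite eq_le sb.
  left; exists p => //; split => //; last by rewrite -sE.
  have p0R : 0 < p.1%:R :> R by rewrite ltr0n.
  by rewrite -ler_pdivlMr// -ltr_pdivrMr// -sE as_.
move=> [[p [p0 pp hp hD] <-]|[]//].
have /andP[h1 h2] := star_slope _ _ _ _ p0 hp.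
by split; [rewrite h1 ltW|exists p].
Qed.

Lemma ncard_slopes D a b Delta : a <= b ->
  finite_set (star R D a b Delta) ->
  finite_set (slopes D a b Delta) /\
  (ncard (star R D a b Delta) <= ncard (slopes D a b Delta)
     <= (ncard (star R D a b Delta)).+1)%N.
Proof.
move=> ab fin; have fI := finite_image (fun p : nat * int => p.2%:~R / p.1%:R : R) fin.
have fb : finite_set (slopes D a b Delta `&` [set b]) by exact: finite_setIr.
split; first by rewrite slopesE// finite_setU.
rewrite slopesE// ncard_setU//; last first.
  apply/seteqP; split => s //= [[p [p0 _ hp _] <-] [_ sb]].
  have /andP[_] := star_slope _ _ _ _ p0 hp.
  by rewrite sb ltxx.
rewrite ncard_image//; last first.
  move=> p q; rewrite !inE => -[p0 pp _ _] [q0 pq _ _].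
  exact: coprime_ratio_inj.
rewrite leq_addr -addn1 leq_add2l -(ncard_set1 b).
by apply: ncard_le => //; exact: subIsetr.
Qed.

Lemma ncard_slopes_cvg : exists2 c : R, 0 < c &
  forall D W a b, a <= b ->
  (forall x, a <= x <= b -> 0 < D x) ->
  (forall x, a <= x <= b -> {for x, continuous D}) ->
  (forall x, a <= x <= b -> is_derive x 1 W (D x)^-1) ->
  (forall Delta, finite_set (slopes D a b Delta)) /\
  forall e, 0 < e -> \forall Delta \near +oo,
    `|(ncard (slopes D a b Delta))%:R - c * (W b - W a) * Delta| <= e * Delta.
Proof.
have [c c0 hc] := ncard_star R; exists c => // D W a b ab D0 Dc DW.
have [fin h] := hc D W a b ab D0 Dc DW; split.
  by move=> Delta; have [] := ncard_slopes D a b Delta ab (fin Delta).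
move=> e e0; have e2 : 0 < e / 2 by rewrite divr_gt0.
have {}h := h _ e2; near=> Delta.
have := ncard_slopes D a b Delta ab (fin Delta) => -[_ /andP[]].
rewrite -!(ler_nat R) -natr1 => h1 h2.
have : `|(ncard (star R D a b Delta))%:R - c * (W b - W a) * Delta| <= e / 2 * Delta.
  by near: Delta.
have : 1 <= e / 2 * Delta.
  by rewrite -ler_pdivrMl//; near: Delta; apply: nbhs_pinfty_ge; exact: num_real.
move: h1 h2; move: (_ * Delta) (ncard _)%:R (ncard _)%:R => A B C h1 h2 h3.
rewrite !ler_norml => /andP[h4 h5]; apply/andP; split; lra.
Unshelve. all: by end_near. Qed.

End slopes.

(* Hermite normal form: k is the least positive ordinate on the vertical axis,
   a the least positive abscissa. *)
Lemma lattice_basis (L : set (int * int)) :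
  (forall p q, L p -> L q -> L (p - q)) ->
  (exists2 p, L p & 0 < p.1) -> (exists2 p, L p & p.1 = 0 /\ 0 < p.2) ->
  exists a b k : int, [/\ 0 < a, 0 < k &
    forall p, L p <-> exists m n : int, p = (m * a, m * b + n * k)].
Proof.
move=> LB [[p1 p2] Lp /= p10] [[q1 q2] Lq /= [q1E q20]]; subst q1.
have L0 : L 0 by rewrite -(subrr (p1, p2)); exact: LB.
have LN p : L p -> L (- p) by move=> Lp'; rewrite -sub0r; exact: LB.
have LD p q : L p -> L q -> L (p + q).
  by move=> Lp' Lq'; rewrite -(opprK q); apply: LB => //; exact: LN.
have LMn p (n : nat) : L p -> L (n%:Z * p.1, n%:Z * p.2).
  move=> Lp'; elim: n => [|n IH]; first by rewrite !mul0r.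
  rewrite intS !mulrDl !mul1r; have := LD _ _ Lp' IH.
  by case: (p).
have LM p (n : int) : L p -> L (n * p.1, n * p.2).
  move=> Lp'; case: n => n; first exact: LMn.
  by rewrite NegzE !mulNr; exact: LN (LMn _ n.+1 Lp').
pose P1 n := (0 < n)%N && `[<L (0, n%:Z)>].
have /find_ex_minn[k /andP[k0 /asboolP Lk] kmin] : exists n, P1 n.
  exists `|q2|%N; rewrite /P1 absz_gt0 gt_eqF//=; apply/asboolP.
  by rewrite gtz0_abs.
pose P2 n := (0 < n)%N && `[<exists y, L (n%:Z, y)>].
have /find_ex_minn[a /andP[a0 /asboolP[b Lab]] amin] : exists n, P2 n.
  exists `|p1|%N; rewrite /P2 absz_gt0 gt_eqF//=; apply/asboolP; exists p2.
  by rewrite gtz0_abs.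
exists a%:Z, b, k%:Z; split => // -[x y]; split; last first.
  move=> [m [n ->]].
  have -> : (m * a%:Z, m * b + n * k%:Z) =
      (m * a%:Z, m * b) + (n * 0, n * k%:Z).
    by congr pair; rewrite /= mulr0 addr0.
  exact: LD (LM _ m Lab) (LM _ n Lk).
move=> Lxy; have a0' : 0 < a%:Z by []; have k0' : 0 < k%:Z by [].
have := LB _ _ Lxy (LM _ (x %/ a)%Z Lab).
have -> : (x, y) - ((x %/ a)%Z * a%:Z, (x %/ a)%Z * b) =
    ((x %% a)%Z, y - (x %/ a)%Z * b).
  by congr pair; rewrite {1}(divz_eq x a) [LHS]addrC addKr.
set y' := y - _ => L1.
(* A nonzero remainder would be a positive abscissa smaller than a; the same argument with ordinates
   and k gives [yk]. *)
have xa : (x %% a)%Z = 0.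
  have := modz_ge0 x (negbT (gt_eqF a0')); have := ltz_pmod x a0'.
  move: L1; case: (x %% a)%Z => // -[|r] // L1 ra _.
  have : (a <= r.+1)%N by apply: amin; rewrite /P2/=; apply/asboolP; exists y'.
  by rewrite leqNgt; move: ra; rewrite ltz_nat => ->.
rewrite xa in L1.
have := LB _ _ L1 (LM _ (y' %/ k)%Z Lk).
have -> : (0, y') - ((y' %/ k)%Z * 0, (y' %/ k)%Z * k%:Z) = (0, (y' %% k)%Z).
  congr pair; first by rewrite /= mulr0 subrr.
move=> L2.
have yk : (y' %% k)%Z = 0.
  have := modz_ge0 y' (negbT (gt_eqF k0')); have := ltz_pmod y' k0'.
  move: L2; case: (y' %% k)%Z => // -[|r] // L2 rk _.
  have : (k <= r.+1)%N by apply: kmin; rewrite /P1/=; apply/asboolP.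
  by rewrite leqNgt; move: rk; rewrite ltz_nat => ->.
exists (x %/ a)%Z, (y' %/ k)%Z; congr pair.
  by rewrite {1}(divz_eq x a) xa addr0.
rewrite -[X in _ + X]addr0 -yk -divz_eq /y' addrC subrK //.
Qed.

(** * Primitive forms in a rational plane *)

Definition content (Q : bqf) : int := gcdz (gcdz (bqf_a Q) (bqf_b Q)) (bqf_c Q).

Lemma dvdz_content d Q : (d %| content Q)%Z =
  [&& (d %| bqf_a Q)%Z, (d %| bqf_b Q)%Z & (d %| bqf_c Q)%Z].
Proof. by rewrite !dvdz_gcd andbA. Qed.

Section pencil.
Variables (R : realType) (u v : R * R * R).

(* Q is the point p u + q v of the plane spanned by u and v. *)
Definition form_at (Q : bqf) (p q : R) : Prop :=
  [/\ (bqf_a Q)%:~R = p * u.1.1 + q * v.1.1,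
      (bqf_b Q)%:~R = p * u.1.2 + q * v.1.2 &
      (bqf_c Q)%:~R = p * u.2 + q * v.2].

Lemma form_at_div Q p q (d : int) : d != 0 -> form_at Q p q ->
  (d %| content Q)%Z -> exists Q', form_at Q' (p / d%:~R) (q / d%:~R).
Proof.
move=> d0 [h1 h2 h3]; rewrite dvdz_content => /and3P[].
move=> /dvdzP[a aE] /dvdzP[b bE] /dvdzP[c cE].
have d0R : d%:~R != 0 :> R by rewrite intr_eq0.
rewrite aE bE cE !intrM in h1 h2 h3.
exists (BQF a b c); split => /=; apply: (mulIf d0R).
- by rewrite h1; field.
- by rewrite h2; field.
- by rewrite h3; field.
Qed.

(** The coordinates (p, q) of integral forms are closed under subtraction. [discrete] bounds their
    denominators, and [full1] and [full2] provide rank two in the triangular shape of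
    [lattice_basis]. The rationality of G enters through these three facts. *)
Hypothesis discrete : exists2 N : nat, (0 < N)%N & forall Q p q,
  form_at Q p q -> exists i j : int, p = i%:~R / N%:R /\ q = j%:~R / N%:R.
Hypothesis full1 : exists Q p q, 0 < p /\ form_at Q p q.
Hypothesis full2 : exists Q q, 0 < q /\ form_at Q 0 q.

Lemma form_at_basis : exists al be ka : R, [/\ 0 < al, 0 < ka & forall p q,
  (exists Q, form_at Q p q) <->
  exists m n : int, p = m%:~R * al /\ q = m%:~R * be + n%:~R * ka].
Proof.
have [N N0 hN] := discrete.
have N0R : 0 < N%:R :> R by rewrite ltr0n.
have [|||a [b [k [a0 k0 hL]]]] := @lattice_basis
  [set ij : int * int | exists Q, form_at Q (ij.1%:~R / N%:R) (ij.2%:~R / N%:R)].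
- move=> [i j] [i' j'] [[A B C] /= [h1 h2 h3]] [[A' B' C'] /= [h1' h2' h3']].
  exists (BQF (A - A') (B - B') (C - C')); split => /=.
  + by rewrite intrB h1 h1' !intrB; ring.
  + by rewrite intrB h2 h2' !intrB; ring.
  + by rewrite intrB h3 h3' !intrB; ring.
- have [Q [p [q [p0 hQ]]]] := full1; have [i [j [pE qE]]] := hN _ _ _ hQ.
  exists (i, j) => /=; first by exists Q; rewrite -pE -qE.
  by move: p0; rewrite pE pmulr_lgt0 ?invr_gt0// ltr0z.
- have [Q [q [q0 hQ]]] := full2; have [i [j [pE qE]]] := hN _ _ _ hQ.
  exists (0, j) => /=; first by exists Q; rewrite mul0r -qE.
  by split => //; move: q0; rewrite qE pmulr_lgt0 ?invr_gt0// ltr0z.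
exists (a%:~R / N%:R), (b%:~R / N%:R), (k%:~R / N%:R); split.
- by rewrite divr_gt0// ltr0z.
- by rewrite divr_gt0// ltr0z.
- move=> p q; split.
    move=> [Q hQ]; have [i [j [pE qE]]] := hN _ _ _ hQ.
    have /(hL (i, j))[m [n [iE jE]]] : exists Q, form_at Q (i%:~R / N%:R) (j%:~R / N%:R).
      by exists Q; rewrite -pE -qE.
    exists m, n; rewrite pE qE iE jE !intrD !intrM; split; ring.
  move=> [m [n [-> ->]]].
  have /(hL (m * a, m * b + n * k))[Q] :
    exists m' n' : int, (m * a, m * b + n * k) = (m' * a, m' * b + n' * k).
    by exists m, n.
  rewrite /= !intrD !intrM => hQ; exists Q; move: hQ.
  by rewrite mulrDl !mulrA.
Qed.

(** The lattice consists of all integral forms of the plane, so it is saturated: if d divides a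
    form, the quotient is again in the lattice. Hence the content of a form and the gcd of its
    lattice coordinates have the same divisors. *)
Lemma primitive_form_basis : exists al be ka : R,
  [/\ 0 < al, 0 < ka & forall p q,
  (exists2 Q, form_at Q p q & content Q = 1) <->
  exists m n : int, [/\ coprimez m n, p = m%:~R * al &
                        q = m%:~R * be + n%:~R * ka]].
Proof.
have [al [be [ka [al0 ka0 hb]]]] := form_at_basis.
exists al, be, ka; split => // p q.
have inj (m n m' n' : int) : m%:~R * al = m'%:~R * al ->
    m%:~R * be + n%:~R * ka = m'%:~R * be + n'%:~R * ka -> m = m' /\ n = n'.
  move=> /(mulIf (negbT (gt_eqF al0)))/eqP; rewrite eqr_int => /eqP ->.
  by move=> /addrI/(mulIf (negbT (gt_eqF ka0)))/eqP; rewrite eqr_int => /eqP ->.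
split.
  move=> [Q hQ Q1]; have /hb[m [n [pE qE]]] : exists Q, form_at Q p q by exists Q.
  exists m, n; split => //; rewrite coprimezE.
  have d1 : (gcdz m n %| content Q)%Z.
    have [h1 h2 h3] := hQ; rewrite pE qE in h1 h2 h3.
    move: (dvdz_gcdl m n) (dvdz_gcdr m n); move: (gcdz m n) => g.
    move=> /dvdzP[m' mE] /dvdzP[n' nE]; rewrite mE nE !intrM in h1 h2 h3.
    have /hb[Q' [h1' h2' h3']] : exists m0 n0 : int,
        m'%:~R * al = m0%:~R * al /\
        m'%:~R * be + n'%:~R * ka = m0%:~R * be + n0%:~R * ka by exists m', n'.
    rewrite dvdz_content; apply/and3P; split; apply/dvdzP.
    - exists (bqf_a Q'); apply: (@intr_inj R); rewrite h1 intrM h1'; ring.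
    - exists (bqf_b Q'); apply: (@intr_inj R); rewrite h2 intrM h2'; ring.
    - exists (bqf_c Q'); apply: (@intr_inj R); rewrite h3 intrM h3'; ring.
  by move: d1; rewrite Q1 dvdzE/= dvdn1.
move=> [m [n [mn pE qE]]].
have /hb[Q hQ] : exists m0 n0 : int, p = m0%:~R * al /\ q = m0%:~R * be + n0%:~R * ka.
  by exists m, n.
exists Q => //.
have key (d : int) : d != 0 -> (d %| content Q)%Z -> (d %| 1)%Z.
  move=> d0 dQ; have [Q' hQ'] := form_at_div _ _ _ _ d0 hQ dQ.
  have /hb[m' [n' [pE' qE']]] : exists Q, form_at Q (p / d%:~R) (q / d%:~R) by exists Q'.
  have d0R : d%:~R != 0 :> R by rewrite intr_eq0.
  have [||mE nE] := inj m n (m' * d) (n' * d).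
  - by rewrite -pE intrM mulrAC -pE' divfK.
  - rewrite -qE !intrM.
    have -> : m'%:~R * d%:~R * be + n'%:~R * d%:~R * ka =
        (m'%:~R * be + n'%:~R * ka) * d%:~R by ring.
    by rewrite -qE' divfK.
  have : (d %| gcdz m n)%Z by rewrite dvdz_gcd mE nE !dvdz_mull.
  by move: mn; rewrite /coprimez => /eqP ->.
(* Content 0 would be divisible by 2, and [key] would make 2 divide 1. *)
have [c0|c0] := eqVneq (content Q) 0.
  by have := key 2 isT; rewrite c0 => /(_ (dvdz0 _)).
have := key _ c0 (dvdzz _); rewrite dvdzE dvdn1 => /eqP.
by rewrite /content /gcdz /= => ->.
Qed.

(* The reals xi for which u + xi v is proportional to a primitive form whose
   discriminant is at most Delta, when E xi is the discriminant of u + xi v. *)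
Definition pencil_points (E : R -> R) (a b Delta : R) : set R :=
  [set xi | a <= xi <= b /\ exists Q p, [/\ 0 < p, form_at Q p (p * xi),
     content Q = 1 & p ^+ 2 * E xi <= Delta]].

(** With p = m al and p xi = m be + n ka, the parameter xi is the affine function [l] of the slope n
    / m, and p^2 E(xi) = m^2 al^2 E(l(n / m)). The factor al ka dividing c is the covolume of the
    lattice. *)
Lemma ncard_pencil_points : exists2 c : R, 0 < c &
  forall (E W : R -> R) a b, a <= b ->
  (forall x, a <= x <= b -> 0 < E x) ->
  (forall x, a <= x <= b -> {for x, continuous E}) ->
  (forall x, a <= x <= b -> is_derive x 1 W (E x)^-1) ->
  (forall Delta, finite_set (pencil_points E a b Delta)) /\
  forall e, 0 < e -> \forall Delta \near +oo,
    `|(ncard (pencil_points E a b Delta))%:R - c * (W b - W a) * Delta| <=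
      e * Delta.
Proof.
have [c c0 hc] := ncard_slopes_cvg R.
have [al [be [ka [al0 ka0 hb]]]] := primitive_form_basis.
exists (c / (al * ka)); first by rewrite divr_gt0// mulr_gt0.
move=> E W a b ab E0 Ec EW.
have alN : al != 0 by rewrite gt_eqF.
have kaN : ka != 0 by rewrite gt_eqF.
pose l s := (be + ka * s) / al.
pose l' x := (al * x - be) / ka.
have lK : cancel l l' by move=> s; rewrite /l/l'; field; rewrite kaN.
have l'K : cancel l' l by move=> s; rewrite /l/l'; field; rewrite alN.
have l_le s t : (l s <= l t) = (s <= t).
  by rewrite /l ler_pM2r ?invr_gt0// lerD2l ler_pM2l.
have l_itv s : (l' a <= s <= l' b) = (a <= l s <= b).
  by rewrite -[l' a <= s]l_le -[s <= l' b]l_le !l'K.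
pose D s := al ^+ 2 * E (l s).
have -> : pencil_points E a b = fun Delta => l @` slopes R D (l' a) (l' b) Delta.
  apply/funext => Delta; apply/seteqP; split => xi /=.
    move=> [xab [Q [p [p0 hQ Q1 pD]]]].
    have /hb[m [n [mn pE qE]]] : exists2 Q, form_at Q p (p * xi) & content Q = 1.
      by exists Q.
    have m0 : 0 < m by move: p0; rewrite pE pmulr_lgt0// ltr0z.
    have m0R : 0 < m%:~R :> R by rewrite ltr0z.
    have xiE : xi = l (n%:~R / m%:~R).
      apply: (mulfI (negbT (gt_eqF p0))); rewrite qE pE /l; field.
      by rewrite alN gt_eqF.
    exists (n%:~R / m%:~R) => //; split; first by rewrite l_itv -xiE.
    exists (`|m|%N, n) => /=.
    have mE : `|m|%N%:R = m%:~R :> R by rewrite natr_absz gtr0_norm.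
    split => //; first by rewrite absz_gt0 gt_eqF.
      by rewrite mE.
    by rewrite mE /D -xiE; move: pD; rewrite pE exprMn mulrA.
  move=> [s [sab [[m n] /= [m0 mn sE hD]]] <-]; split; first by rewrite -l_itv.
  have m0R : 0 < m%:R :> R by rewrite ltr0n.
  have /hb[Q hQ Q1] : exists m1 n1 : int, [/\ coprimez m1 n1,
      m%:R * al = m1%:~R * al & m%:R * al * l s = m1%:~R * be + n1%:~R * ka].
    exists m%:Z, n; split => //.
    rewrite sE /l -[m%:Z%:~R]/(m%:R); field.
    by rewrite alN gt_eqF.
  exists Q, (m%:R * al); split => //; first by rewrite mulr_gt0.
  by rewrite exprMn -mulrA.
(* W after l has derivative (ka / al) / E(l s); dividing by al ka yields 1 / (al^2 E(l s)) = 1 / D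
   s. *)
have [||||fin h] := hc D ((al * ka)^-1 \*: (W \o l)) (l' a) (l' b).
- by rewrite -l_le !l'K.
- by move=> s; rewrite l_itv => /E0; rewrite /D => h; rewrite mulr_gt0// exprn_gt0.
- move=> s; rewrite l_itv => /Ec cE; apply: cvgM; first exact: cvg_cst.
  apply: (@continuous_comp _ _ _ l E s) => //.
  apply: cvgM; last exact: cvg_cst.
  by apply: cvgD; [exact: cvg_cst|apply: cvgM; [exact: cvg_cst|exact: cvg_id]].
- move=> s; rewrite l_itv => sab.
  have dl : is_derive s 1 l (ka / al).
    have -> : l = cst (be / al) + (ka / al) \*: id.
      by apply/funext => t; rewrite /l /= mulrDl mulrAC.
    by apply: is_derive_eq; rewrite add0r scaler1.
  have dW := is_derive1_comp (EW _ sab) dl.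
  apply: is_derive_eq; rewrite /D /GRing.scale/=; field.
  by rewrite alN kaN gt_eqF//= E0.
split; first by move=> Delta; exact: finite_image.
move=> e e0; have := h e e0; apply: filterS => Delta.
rewrite ncard_image//; last by move=> s t _ _; exact: (can_inj lK).
by rewrite /= /GRing.scale/= !l'K -mulrBr !mulrA [c / _ * _]mulrAC.
Qed.

End pencil.

(** * Hyperbolic lengths *)

Lemma is_derive_continuous (R : realType) (f : R -> R) (x df : R) :
  is_derive x 1 f df -> {for x, continuous f}.
Proof. by move=> h; apply/differentiable_continuous/derivable1_diffP. Qed.

Lemma Rintegral_antiderivative (R : realType) (f g F : R -> R) (s t : R) :
  s <= t ->
  (forall x, s <= x <= t -> is_derive x 1 F (f x)) ->
  (forall x, s <= x <= t -> {for x, continuous f}) ->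
  (forall x, s <= x <= t -> g x = f x) ->
  \int[lebesgue_measure]_(x in `[s, t]) g x = F t - F s.
Proof.
move=> st Ff fc gf.
have -> : \int[lebesgue_measure]_(x in `[s, t]) g x =
          \int[lebesgue_measure]_(x in `[s, t]) f x.
  by apply: eq_Rintegral => x; rewrite inE/= in_itv/=; exact: gf.
(* Degenerate arcs are allowed, whereas the fundamental theorem is applied on s < t. *)
move: st; rewrite le_eqVlt => /predU1P[->|st].
  by rewrite set_itv1 Rintegral_set1 subrr.
have sst : s <= s <= t by rewrite lexx ltW.
have stt : s <= t <= t by rewrite lexx ltW.
rewrite /Rintegral (@continuous_FTC2 _ f F)//.
- by apply: continuous_in_subspaceT => x; rewrite inE/= in_itv/=; exact: fc.
- split.
  + by move=> x; rewrite in_itv/= => /andP[sx xt]; have [] := Ff x; rewrite ?ltW.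
  + by apply: cvg_at_right_filter; exact: is_derive_continuous (Ff _ sst).
  + by apply: cvg_at_left_filter; exact: is_derive_continuous (Ff _ stt).
- move=> x; rewrite in_itv/= => /andP[sx xt].
  by rewrite derive1E; have [] := Ff x; rewrite ?ltW.
Qed.

Section lengths.
Local Open Scope complex_scope.
Variable R : realType.

Lemma velocity_vertical (x t : R) : velocity (geo_param (Vertical x)) t = 0 +i* 1.
Proof.
rewrite /velocity/=; congr Complex; first exact: derive1_cst.
by rewrite derive1E derive_id.
Qed.

Lemma velocity_semicircle (q : R) (r : {posnum R}) t :
  velocity (geo_param (Semicircle q r)) t =
  (- r%:num * sin t) +i* (r%:num * cos t).
Proof.
rewrite /velocity/=; congr Complex; rewrite derive1E.
  have h : is_derive t 1 (cst q + r%:num \*: cos) (- r%:num * sin t).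
    by apply: is_derive_eq; rewrite /GRing.scale/= add0r mulrN mulNr.
  by have [_ h2] := h; exact: h2.
have h : is_derive t 1 (r%:num \*: sin) (r%:num * cos t).
  by apply: is_derive_eq.
by have [_ h2] := h; exact: h2.
Qed.

Lemma hyp_length_vertical (x s t : R) : 0 < s -> s <= t ->
  hyp_length (Vertical x) s t = ln t - ln s.
Proof.
move=> s0 st; apply: (@Rintegral_antiderivative _ (fun u => u^-1)) => // u /andP[su _].
all: have u0 : 0 < u by exact: lt_le_trans su.
- exact: is_derive1_ln.
- by apply: cvgV; [rewrite gt_eqF|exact: cvg_id].
- rewrite velocity_vertical /hyp_norm /hyp_inner /= !mul0r add0r mulr1.
  by rewrite mul1r -exprVn sqrtr_sqr gtr0_norm// invr_gt0.
Qed.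

(** This is ln tan (th / 2), written through cos th because the pencil parameter on a semicircle is
    cos th / r. *)
Definition semicircle_primitive (th : R) : R :=
  2^-1 * (ln (1 - cos th) - ln (1 + cos th)).

Lemma cos_lt1 (th : R) : 0 < th < pi -> 0 < 1 - cos th /\ 0 < 1 + cos th.
Proof.
move=> th0; have := sin_gt0_pi th0; have := cos2Dsin2 th.
by move: (cos th) (sin th) => c s h s0; split; nra.
Qed.

Lemma is_derive_semicircle_primitive (th : R) : 0 < th < pi ->
  is_derive th 1 semicircle_primitive (sin th)^-1.
Proof.
move=> th0; have [h1 h2] := cos_lt1 th th0.
have s0 := sin_gt0_pi th0.
have d1 : is_derive th 1 (cst 1 - cos) (sin th).
  by apply: is_derive_eq; rewrite sub0r opprK.
have d2 : is_derive th 1 (cst 1 + cos) (- sin th).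
  by apply: is_derive_eq; rewrite add0r.
have e1 := @is_derive1_comp _ (@ln R) (cst 1 - cos) th _ _ (is_derive1_ln h1) d1.
have e2 := @is_derive1_comp _ (@ln R) (cst 1 + cos) th _ _ (is_derive1_ln h2) d2.
have := is_deriveZ 2^-1 (is_deriveB e1 e2).
move/is_derive_eq; apply; rewrite /GRing.scale/=.
have -> : (1 - cos th)^-1 * sin th - (1 + cos th)^-1 * - sin th =
   2 * sin th / ((1 - cos th) * (1 + cos th)) by field; rewrite !gt_eqF.
have -> : (1 - cos th) * (1 + cos th) = sin th ^+ 2 by rewrite sin2cos2; ring.
by field; rewrite gt_eqF.
Qed.

Lemma hyp_length_semicircle (q : R) (r : {posnum R}) s t :
  0 < s -> s <= t -> t < pi ->
  hyp_length (Semicircle q r) s t =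
  semicircle_primitive t - semicircle_primitive s.
Proof.
move=> s0 st tpi.
apply: (@Rintegral_antiderivative _ (fun u => (sin u)^-1)) => // u /andP[su ut].
all: have u0 : 0 < u < pi by rewrite (lt_le_trans s0)//= (le_lt_trans ut).
all: have su0 := sin_gt0_pi u0.
- exact: is_derive_semicircle_primitive.
- by apply: cvgV; [rewrite gt_eqF|exact: continuous_sin].
- rewrite velocity_semicircle /hyp_norm /hyp_inner /=.
  have -> : (- r%:num * sin u * (- r%:num * sin u) + r%:num * cos u * (r%:num * cos u)) =
      r%:num ^+ 2 * (cos u ^+ 2 + sin u ^+ 2) by ring.
  rewrite cos2Dsin2 mulr1 -expr_div_n sqrtr_sqr gtr0_norm ?divr_gt0 ?mulr_gt0//.
  by field; rewrite !gt_eqF.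
Qed.

End lengths.

(** * Perpendicular RM curves *)

Lemma rational_ratio (R : realType) (x : R) : rational x ->
  exists (i : int) (d : nat), (0 < d)%N /\ x = i%:~R / d%:R.
Proof.
move=> [y _ <-]; exists (numq y), `|denq y|%N; split; first by rewrite absz_gt0 denq_neq0.
by rewrite /ratr natr_absz gtr0_norm ?denq_gt0.
Qed.

(** The form is a ((z - q)^2 - r^2), as adding and subtracting the two root equations shows. Given a
    != 0, normalization means a > 0, and the discriminant is 4 a^2 r^2. *)
Lemma RM_curve_semicircle (R : realType) (Q : bqf) (q : R) (r : {posnum R}) :
  RM_curve Q (Semicircle q r) <->
  [/\ content Q = 1, 0 < bqf_a Q, (bqf_b Q)%:~R = - 2 * (bqf_a Q)%:~R * q &
      (bqf_c Q)%:~R = (bqf_a Q)%:~R * (q ^+ 2 - r%:num ^+ 2)].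
Proof.
have r0 : 0 < r%:num by [].
case: Q => a b c; rewrite /RM_curve /normalized /disc /content /is_root/=; split.
  move=> [[gabc apos] _ a0 [h1 h2]].
  have a0' : 0 < a by case: apos => [//|[]//|[]//].
  have bE : b%:~R = - 2 * a%:~R * q.
    by apply: (mulIf (negbT (gt_eqF r0))); lra.
  by split => //; rewrite bE in h1 h2; lra.
move=> [g a0 bE cE]; split.
- by split => //; exact: Or31.
- have a0R : 0 < a%:~R :> R by rewrite ltr0z.
  rewrite -(ltr0z R) intrB !intrM bE cE.
  have -> : (- 2 * a%:~R * q) ^+ 2 - 4%:~R * a%:~R * (a%:~R * (q ^+ 2 - r%:num ^+ 2)) =
    4 * a%:~R ^+ 2 * r%:num ^+ 2 by ring.
  by rewrite !mulr_gt0// exprn_gt0.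
- by move=> a00; rewrite a00 in a0.
- by split; rewrite bE cE; ring.
Qed.

Lemma disc_RM_curve (R : realType) (Q : bqf) (q : R) (r : {posnum R}) :
  RM_curve Q (Semicircle q r) ->
  (disc Q)%:~R = 4 * (bqf_a Q)%:~R ^+ 2 * r%:num ^+ 2 :> R.
Proof.
move=> /RM_curve_semicircle[_ _ bE cE].
by rewrite /disc intrB !intrM bE cE; ring.
Qed.

Section vertical.
Local Open Scope complex_scope.
Variables (R : realType) (x : R).

(** u + xi v is the form (z - x)^2 - xi, of discriminant 4 xi, whose semicircle is centered at x and
    crosses the line at height sqrt xi. *)
Definition vertical_u : R * R * R := (1, - 2 * x, x ^+ 2).
Definition vertical_v : R * R * R := (0, 0, -1).

Lemma vertical_RM_cap (s t Delta : R) : 0 < s -> s <= t ->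
  subarc (Vertical x) s t `&` RM_cap (Vertical x) Delta =
  (fun xi => x +i* Num.sqrt xi) @`
    pencil_points R vertical_u vertical_v (fun xi => 4 * xi) (s ^+ 2) (t ^+ 2) Delta.
Proof.
move=> s0 st; have t0 : 0 < t by exact: lt_le_trans st.
apply/seteqP; split => z /=.
  move=> [[y /=]]; rewrite in_itv/= => /andP[sy yt] <-.
  move=> [Q [[?|q r] [RQ hD]]]; first by case: RQ.
  move=> [s' [t' [hs' _ + _ ]]].
  rewrite velocity_vertical velocity_semicircle /hyp_inner/= mulr0 add0r mulr1.
  move=> [e1 e2].
  have y0 : 0 < y by exact: lt_le_trans sy.
  (* Orthogonality to the vertical direction is cos s' = 0: the point is the top of the semicircle,
     so x is its center and y its radius. *)
  move/eqP; rewrite mulf_eq0 invr_eq0 sqrf_eq0 (gt_eqF y0) orbF mulf_eq0.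
  rewrite gt_eqF//= => /eqP cs0.
  have sn1 : sin s' = 1.
    have := cos2Dsin2 s'; rewrite cs0 expr0n add0r => h.
    have := sin_gt0_pi hs'; nra.
  rewrite cs0 mulr0 addr0 in e1; rewrite sn1 mulr1 in e2.
  have [Q1 a0 bE cE] := (RM_curve_semicircle _ _ _ _).1 RQ.
  exists (y ^+ 2); last by rewrite sqrtr_sqr gtr0_norm.
  split; first by rewrite !lerXn2r ?nnegrE// ?ltW// (lt_le_trans y0).
  exists Q, (bqf_a Q)%:~R; split => //.
  - by rewrite ltr0z.
  - split => /=.
    + by ring.
    + by rewrite bE e1; ring.
    + by rewrite cE e1 e2; ring.
  - by move: hD; rewrite (disc_RM_curve _ _ _ _ RQ) e2; lra.
move=> [xi [/andP[sxi xit] [Q [p [p0 [/= aE bE cE] Q1 hD]]]] <-].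
have xi0 : 0 < xi by apply: lt_le_trans sxi; rewrite exprn_gt0.
set y := Num.sqrt xi.
have y0 : 0 < y by rewrite sqrtr_gt0.
have yE : xi = y ^+ 2 by rewrite sqr_sqrtr// ltW.
split.
  exists y => //=; rewrite in_itv/=.
  have sy2 : s ^+ 2 <= y ^+ 2 by rewrite -yE.
  have yt2 : y ^+ 2 <= t ^+ 2 by rewrite -yE.
  by apply/andP; split; nra.
have RQ : RM_curve Q (Semicircle x (PosNum y0)).
  apply/RM_curve_semicircle; split => //=.
  - by rewrite -(ltr0z R) aE mulr1 mulr0 addr0.
  - by rewrite aE bE; ring.
  - by rewrite aE cE yE; ring.
exists Q, (Semicircle x (PosNum y0)); split => //.
  by rewrite (disc_RM_curve _ _ _ _ RQ)/= aE; move: hD; rewrite yE; lra.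
exists (pi / 2), y; split.
- by have := pi_gt0 R; rewrite /=; lra.
- by [].
- by rewrite /= cos_pihalf mulr0 addr0 sin_pihalf mulr1.
- by [].
- rewrite velocity_vertical velocity_semicircle /hyp_inner/= cos_pihalf.
  by rewrite !(mulr0, mul0r, addr0).
Qed.

Lemma vertical_discrete : rational x -> exists2 N : nat, (0 < N)%N &
  forall Q p q, form_at R vertical_u vertical_v Q p q ->
  exists i j : int, p = i%:~R / N%:R /\ q = j%:~R / N%:R.
Proof.
(* Here p = a and q = a x^2 - c, so the squared denominator of x clears both. *)
move=> /rational_ratio[i [d [d0 xE]]]; exists (d ^ 2)%N; first by rewrite expn_gt0 d0.
have dN : d%:R != 0 :> R by rewrite pnatr_eq0 -lt0n.
move=> Q p q [/= aE bE cE].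
exists (bqf_a Q * d%:Z ^+ 2), (bqf_a Q * i ^+ 2 - bqf_c Q * d%:Z ^+ 2).
rewrite intrB !intrM natrX -![d%:Z%:~R]/(d%:R); split; first by rewrite aE; field.
have -> : (bqf_c Q)%:~R = p * x ^+ 2 - q by rewrite cE; ring.
by rewrite aE xE; field.
Qed.

Lemma vertical_full1 : rational x ->
  exists Q p q, 0 < p /\ form_at R vertical_u vertical_v Q p q.
Proof.
move=> /rational_ratio[i [d [d0 xE]]].
have dN : d%:R != 0 :> R by rewrite pnatr_eq0 -lt0n.
exists (BQF (d%:Z ^+ 2) (- 2 * i * d%:Z) (i ^+ 2)), (d%:R ^+ 2), 0.
split; first by rewrite exprn_gt0// ltr0n.
by split; rewrite /= ?intrM -?[d%:Z%:~R]/(d%:R) ?xE; field.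
Qed.

Lemma vertical_full2 :
  exists Q q, 0 < q /\ form_at R vertical_u vertical_v Q 0 q.
Proof.
by exists (BQF 0 0 (-1)), 1; split => //; split => /=; ring.
Qed.

End vertical.

Section semicircle.
Local Open Scope complex_scope.
Variables (R : realType) (q : R) (r : {posnum R}).

(** u is -2 (z - q), the vertical line over the center, and v is (z - q)^2 + r^2. They span the
    plane of perpendicular forms; u + xi v has discriminant 4 (1 - r^2 xi^2) and, for xi != 0,
    center q + 1 / xi. *)
Definition semicircle_u : R * R * R := (0, - 2, 2 * q).
Definition semicircle_v : R * R * R := (1, - 2 * q, q ^+ 2 + r%:num ^+ 2).

Lemma semicircle_discrete : rational q -> exists2 N : nat, (0 < N)%N &
  forall Q p w, form_at R semicircle_u semicircle_v Q p w ->
  exists i j : int, p = i%:~R / N%:R /\ w = j%:~R / N%:R.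
Proof.
(* Here w = a and p = - (b + 2 q a) / 2, whence the denominator 2 d. *)
move=> /rational_ratio[i [d [d0 qE]]]; exists (2 * d)%N; first by rewrite muln_gt0.
have dN : d%:R != 0 :> R by rewrite pnatr_eq0 -lt0n.
move=> Q p w [/= aE bE cE].
exists (- (bqf_b Q * d%:Z + 2 * i * bqf_a Q)), (bqf_a Q * (2 * d)%:Z).
rewrite intrN intrD !intrM natrM -![d%:Z%:~R]/(d%:R) -![(2 * d)%:Z%:~R]/((2 * d)%:R).
by rewrite natrM bE aE qE; split; field.
Qed.

Lemma semicircle_full1 : rational q ->
  exists Q p w, 0 < p /\ form_at R semicircle_u semicircle_v Q p w.
Proof.
move=> /rational_ratio[i [d [d0 qE]]].
have dN : d%:R != 0 :> R by rewrite pnatr_eq0 -lt0n.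
exists (BQF 0 (- 2 * d%:Z) (2 * i)), d%:R, 0.
split; first by rewrite ltr0n.
by split; rewrite /= ?intrM -?[d%:Z%:~R]/(d%:R) ?qE; field.
Qed.

Lemma semicircle_full2 : rational q -> rational (r%:num ^+ 2) ->
  exists Q w, 0 < w /\ form_at R semicircle_u semicircle_v Q 0 w.
Proof.
move=> /rational_ratio[i [d [d0 qE]]] /rational_ratio[j [e [e0 rE]]].
have dN : d%:R != 0 :> R by rewrite pnatr_eq0 -lt0n.
have eN : e%:R != 0 :> R by rewrite pnatr_eq0 -lt0n.
(* This is d^2 e ((z - q)^2 + r^2), integral because r^2 = j / e is rational. *)
exists (BQF (d%:Z ^+ 2 * e%:Z) (- 2 * i * d%:Z * e%:Z) (i ^+ 2 * e%:Z + j * d%:Z ^+ 2)).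
exists (d%:R ^+ 2 * e%:R).
split; first by rewrite mulr_gt0 ?exprn_gt0// ltr0n.
by split; rewrite /= ?intrD !intrM ?rE ?qE; field; rewrite ?dN ?eN.
Qed.

Definition semicircle_point (xi : R) : R[i] :=
  (q + r%:num * (r%:num * xi)) +i* (r%:num * Num.sqrt (1 - (r%:num * xi) ^+ 2)).

(* xi = cos theta / r is the inverse of the distance between the centers. *)
Lemma semicircle_RM_cap (s t Delta : R) : 0 < s -> s <= t -> t < pi ->
  subarc (Semicircle q r) s t `&` RM_cap (Semicircle q r) Delta =
  semicircle_point @`
    (pencil_points R semicircle_u semicircle_v
      (fun xi => 4 * (1 - r%:num ^+ 2 * xi ^+ 2))
      (cos t / r%:num) (cos s / r%:num) Delta `\ 0).
Proof.
move=> s0 st tpi; have r0 : 0 < r%:num by [].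
have rN : r%:num != 0 by rewrite gt_eqF.
have dom th : s <= th <= t -> 0 < th < pi.
  by move=> /andP[h1 h2]; rewrite (lt_le_trans s0)//= (le_lt_trans h2).
have dom' (th : R) : 0 < th < pi -> th \in `[0, pi].
  by move=> /andP[h1 h2]; rewrite in_itv/= !ltW.
have cos_itv th : 0 < th < pi ->
    (cos t / r%:num <= cos th / r%:num <= cos s / r%:num) = (s <= th <= t).
  have ds : 0 < s < pi by apply: dom; rewrite lexx.
  have dt : 0 < t < pi by apply: dom; rewrite lexx andbT.
  move=> hth; rewrite !ler_pM2r ?invr_gt0//.
  rewrite (leNgt (cos t)) (leNgt (cos th)) !ltr_cos ?dom'//.
  by rewrite -!leNgt andbC.
have pointE th : 0 < th < pi ->
    semicircle_point (cos th / r%:num) = geo_param (Semicircle q r) th.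
  move=> hth; have sn0 := sin_gt0_pi hth.
  have e : r%:num * (cos th / r%:num) = cos th by field.
  by rewrite /semicircle_point e -sin2cos2 sqrtr_sqr gtr0_norm.
apply/seteqP; split => z /=.
  move=> [[th /=]]; rewrite in_itv/= => hth <-; have th0 := dom _ hth.
  have sn0 := sin_gt0_pi th0; have cs2 := cos2Dsin2 th.
  move=> [Q [[?|q' r'] [RQ hD]]]; first by case: RQ.
  move=> [s' [th' [hs' _ + + ]]].
  rewrite !velocity_semicircle /hyp_inner/= => e1 [e3 e4].
  have r'0 : 0 < r'%:num by [].
  have e3' : cos th' = cos th by apply: (mulfI rN); lra.
  have e4' : sin th' = sin th by apply: (mulfI rN); lra.
  rewrite e3' e4'; move: e1 => [e1 e2].
  have im0 : r%:num * sin th != 0 by rewrite mulf_neq0// gt_eqF.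
  move/eqP; rewrite mulf_eq0 invr_eq0 sqrf_eq0 (negbTE im0) orbF => /eqP e5.
  set w := q' - q.
  have wE : w = r%:num * cos th - r'%:num * cos s' by rewrite /w; lra.
  have e6 : r'%:num * (sin s' * sin th + cos s' * cos th) = 0.
    by apply: (mulfI rN); lra.
  (* The two centers and the point form a triangle with its right angle at the point: w cos th = r,
     and then w^2 = r^2 + r'^2. In particular cos th != 0. *)
  have wc : w * cos th = r%:num.
    rewrite wE -[RHS]mulr1 -cs2.
    have -> : r%:num * (cos th ^+ 2 + sin th ^+ 2) =
      r%:num * cos th ^+ 2 + (r%:num * sin th) * sin th by ring.
    by rewrite -e2; lra.
  have cN : cos th != 0.
    by apply/eqP => c0; move: wc; rewrite c0 mulr0 => /esym/eqP; rewrite (negbTE rN).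
  have r'E : r'%:num ^+ 2 = w ^+ 2 - r%:num ^+ 2.
    have cs2' := cos2Dsin2 s'.
    rewrite -[LHS]mulr1 -cs2'.
    have -> : r'%:num ^+ 2 * (cos s' ^+ 2 + sin s' ^+ 2) =
      (r'%:num * cos s') ^+ 2 + (r'%:num * sin s') ^+ 2 by ring.
    have -> : r'%:num * cos s' = r%:num * cos th - w by rewrite wE; ring.
    rewrite e2.
    have -> : (r%:num * cos th - w) ^+ 2 + (r%:num * sin th) ^+ 2 =
      r%:num ^+ 2 * (cos th ^+ 2 + sin th ^+ 2) -
      2 * r%:num * (w * cos th) + w ^+ 2 by ring.
    by rewrite cs2 wc; ring.
  have [Q1 a0 bE cE] := (RM_curve_semicircle _ _ _ _).1 RQ.
  have a0R : 0 < (bqf_a Q)%:~R :> R by rewrite ltr0z.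
  have q'E : q' = q + r%:num / cos th.
    by rewrite -wc mulfK// /w; ring.
  have wE' : w = r%:num / cos th by rewrite -wc mulfK.
  rewrite wE' in r'E.
  exists (cos th / r%:num); last exact: pointE.
  split; last by apply/eqP; rewrite mulf_neq0// invr_eq0.
  split; first by rewrite cos_itv.
  rewrite (disc_RM_curve _ _ _ _ RQ) r'E in hD.
  have hD' : ((bqf_a Q)%:~R * r%:num / cos th) ^+ 2 *
      (4 * (1 - r%:num ^+ 2 * (cos th / r%:num) ^+ 2)) <= Delta.
    apply: le_trans hD; rewrite le_eqVlt; apply/orP; left; apply/eqP.
    by field; rewrite ?cN ?rN.
  (* Normalization asks for a > 0, the pencil for p = a r / cos th > 0; beyond the top of G the form
     has to be negated. *)
  have [c0|c0] := ltP 0 (cos th).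
    exists Q, ((bqf_a Q)%:~R * r%:num / cos th); split => //.
    - by rewrite divr_gt0// mulr_gt0.
    - split => /=.
      + by field; rewrite ?cN ?rN.
      + by rewrite bE q'E; field; rewrite ?cN ?rN.
      + by rewrite cE r'E q'E; field; rewrite ?cN ?rN.
  have c0' : cos th < 0 by rewrite lt_neqAle cN.
  exists (BQF (- bqf_a Q) (- bqf_b Q) (- bqf_c Q)), (- ((bqf_a Q)%:~R * r%:num / cos th)).
  split => //.
  - by rewrite oppr_gt0 pmulr_rlt0 ?mulr_gt0// invr_lt0.
  - split => /=; rewrite intrN.
    + by field; rewrite ?cN ?rN.
    + by rewrite bE q'E; field; rewrite ?cN ?rN.
    + by rewrite cE r'E q'E; field; rewrite ?cN ?rN.
  - by move: Q1; rewrite /content/= /gcdz !absz_nat !abszN.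
  - by rewrite sqrrN.
move=> [xi [[xiab [Q [p [p0 hQ Q1 hD]]]] /eqP xi0] <-].
have ds : 0 < s < pi by apply: dom; rewrite lexx.
have dt : 0 < t < pi by apply: dom; rewrite lexx andbT.
pose th := acos (r%:num * xi).
have [h1 h2] : cos t <= r%:num * xi /\ r%:num * xi <= cos s.
  move: xiab; by rewrite ler_pdivrMr// ler_pdivlMr// ![xi * _]mulrC => /andP.
have [h3 _] := cos_lt1 _ s ds; have [_ h4] := cos_lt1 _ t dt.
have [thge cth] := @acos_def _ (r%:num * xi) ltac:(by apply/andP; split; lra).
rewrite -/th in thge cth.
have th0 : 0 < th < pi.
  move/andP: thge => [th0 thpi]; apply/andP; split.
    rewrite lt_neqAle th0 andbT; apply/eqP => e; move: cth; rewrite -e cos0; lra.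
  rewrite lt_neqAle thpi andbT; apply/eqP => e; move: cth; rewrite e cospi; lra.
have xiE : xi = cos th / r%:num by rewrite cth; field.
move: xiab hQ hD xi0; rewrite {}xiE {cth} pointE// cos_itv// => hth.
move=> [/= aE bE cE] hD cN'.
have sn0 := sin_gt0_pi th0; have cs2 := cos2Dsin2 th.
have cN : cos th != 0.
  by apply: contraNneq cN' => ->; rewrite mul0r.
split; first by exists th => //=; rewrite in_itv.
(* sg is the sign of cos th. The radii to the point are orthogonal, so the angle on the RM curve is
   th + pi / 2 or th - pi / 2, whichever lies in (0, pi); its radius is r |tan th|. *)
have [sg [sg1 sgc [s' [s'0 s'c s's]]]] : exists sg : int,
    [/\ sg = 1 \/ sg = -1, 0 < sg%:~R * cos th &
    exists s', [/\ 0 < s' < pi, cos s' = - sg%:~R * sin th &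
                   sin s' = sg%:~R * cos th]].
  have pi0 := pi_gt0 R.
  have hpi : 0 < (pi / 2 : R) < pi.
    by apply/andP; split; lra.
  move/andP: (th0) => [th1 th2].
  have [c0|c0] := ltP 0 (cos th).
    exists 1; split; [by left|by rewrite mul1r|].
    have {}c0 : th < pi / 2 by rewrite -ltr_cos ?dom'// cos_pihalf.
    exists (th + pi / 2); split.
    - by apply/andP; split; lra.
    - by rewrite cosDpihalf mulN1r.
    - by rewrite sinDpihalf mul1r.
  have {}c0 : cos th < 0 by rewrite lt_neqAle cN.
  exists (-1); split; [by right|by rewrite intrN mulN1r oppr_gt0|].
  have {}c0 : pi / 2 < th by rewrite -ltr_cos ?dom'// cos_pihalf.
  exists (th - pi / 2); split.
  - by apply/andP; split; lra.
  - by rewrite cosBpihalf intrN opprK mul1r.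
  - by rewrite sinBpihalf intrN mulN1r.
have sg2 : sg%:~R * sg%:~R = 1 :> R.
  by case: sg1 => ->; rewrite ?intrN ?mulrNN mulr1.
have r'0 : 0 < r%:num * sin th / (sg%:~R * cos th).
  by rewrite divr_gt0// mulr_gt0.
have sgN : sg%:~R != 0 :> R by case: sg1 => ->; rewrite ?intrN ?oppr_eq0 oner_eq0.
pose Q' := BQF (sg * bqf_a Q) (sg * bqf_b Q) (sg * bqf_c Q).
have sg2' : cos th ^+ 2 = 1 - sin th ^+ 2 by rewrite cos2sin2.
have RQ : RM_curve Q' (Semicircle (q + r%:num / cos th) (PosNum r'0)).
  apply/RM_curve_semicircle; split => /=.
  - move: Q1; rewrite /content /Q'/= /gcdz !absz_nat !abszM.
    by case: sg1 => -> /=; rewrite !mul1n.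
  - rewrite -(ltr0z R) intrM aE.
    have -> : sg%:~R * (p * 0 + p * (cos th / r%:num) * 1) =
      p * (sg%:~R * cos th) / r%:num by ring.
    by rewrite divr_gt0// mulr_gt0.
  - by rewrite !intrM aE bE; field; rewrite cN.
  - have -> : (r%:num * sin th / (sg%:~R * cos th)) ^+ 2 =
      r%:num ^+ 2 * (1 - cos th ^+ 2) / (cos th ^+ 2 * (sg%:~R * sg%:~R)).
      by rewrite -sin2cos2; field; rewrite cN sgN.
    rewrite sg2 !intrM aE cE; field; rewrite cN; lra.
exists Q', (Semicircle (q + r%:num / cos th) (PosNum r'0)); split => //.
  rewrite (disc_RM_curve _ _ _ _ RQ) /Q' /= intrM aE; apply: le_trans hD.
  rewrite le_eqVlt; apply/orP; left; apply/eqP.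
  have -> : 1 - r%:num ^+ 2 * (cos th / r%:num) ^+ 2 = sin th ^+ 2.
    by rewrite sin2cos2; field.
  by field; rewrite cN sgN.
exists s', th; split => //.
- rewrite /= s'c s's; congr Complex.
    have -> : r%:num * sin th / (sg%:~R * cos th) * (- sg%:~R * sin th) =
      - r%:num * sin th ^+ 2 / cos th by field; rewrite cN sgN.
    by rewrite sin2cos2; field; rewrite cN.
  by field; rewrite cN sgN.
- rewrite !velocity_semicircle /hyp_inner/= s'c s's.
  have -> : - (r%:num * sin th / (sg%:~R * cos th)) * (sg%:~R * cos th) *
      (- r%:num * sin th) +
      r%:num * sin th / (sg%:~R * cos th) * (- sg%:~R * sin th) * (r%:num * cos th) = 0.
    by field; rewrite cN sgN.
  by rewrite mul0r.
Qed.

End semicircle.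

(** * Limits of the counts and equidistribution *)

(** N counts pencil points and N' intersection points. The slack of one covers the parameter xi = 0
    on a semicircle and disappears after division by Delta. *)
Lemma cvg_div_of_approx (R : realType) (N N' : R -> nat) (K : R) :
  (forall Delta, (N' Delta <= N Delta <= (N' Delta).+1)%N) ->
  (forall e, 0 < e -> \forall Delta \near +oo,
    `|(N Delta)%:R - K * Delta| <= e * Delta) ->
  (fun Delta => (N' Delta)%:R / Delta : R) @ +oo --> K.
Proof.
move=> NN' hN; apply/cvgrPdist_le => e e0.
have e2 : 0 < e / 2 by rewrite divr_gt0.
have {}hN := hN _ e2; near=> Delta.
have Delta0 : 0 < Delta by near: Delta; exact: nbhs_pinfty_gt.
have h1 : 1 <= e / 2 * Delta.
  by rewrite -ler_pdivrMl//; near: Delta; apply: nbhs_pinfty_ge; exact: num_real.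
have h2 : `|(N Delta)%:R - K * Delta| <= e / 2 * Delta by near: Delta.
have -> : K - (N' Delta)%:R / Delta = (K * Delta - (N' Delta)%:R) / Delta.
  by field; rewrite gt_eqF.
rewrite normrM normfV (gtr0_norm Delta0) ler_pdivrMr//.
have /andP[] := NN' Delta; rewrite -!(ler_nat R) -natr1.
move: (K * Delta) h2 => A; move: ((N Delta)%:R) ((N' Delta)%:R) => n n'.
rewrite !ler_norml => /andP[h3 h4] h5 h6.
by apply/andP; split; lra.
Unshelve. all: by end_near. Qed.

Lemma npoints_vertical (R : realType) (x : R) : rational x ->
  exists2 C : R, 0 < C & forall s t, 0 < s -> s <= t ->
  (fun Delta => (npoints (subarc (Vertical x) s t `&` RM_cap (Vertical x) Delta))%:R
    / Delta : R) @ +oo --> C * hyp_length (Vertical x) s t.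
Proof.
move=> xQ.
have [c c0 hc] := ncard_pencil_points R _ _ (vertical_discrete R x xQ)
  (vertical_full1 R x xQ) (vertical_full2 R x).
(* At xi = y^2 the antiderivative ln xi / 4 of 1 / (4 xi) equals ln y / 2, half the primitive of
   ds_hyp. *)
exists (c / 2); first by rewrite divr_gt0.
move=> s t s0 st; have t0 : 0 < t by exact: lt_le_trans st.
have pos xi : s ^+ 2 <= xi <= t ^+ 2 -> 0 < xi.
  by move=> /andP[+ _]; apply: lt_le_trans; rewrite exprn_gt0.
have [||||fin h] := hc (fun xi => 4 * xi) (4^-1 \*: @ln R) (s ^+ 2) (t ^+ 2).
- by rewrite lerXn2r// nnegrE ltW.
- by move=> xi /pos xi0; rewrite mulr_gt0.
- by move=> xi _; apply: cvgM; [exact: cvg_cst|exact: cvg_id].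
- move=> xi /pos xi0; have := is_derive1_ln xi0 => dln.
  by apply: is_derive_eq; rewrite invfM.
apply: cvg_div_of_approx; last first.
  move=> e e0; have := h e e0; apply: filterS => Delta.
  have -> : c * ((4^-1 \*: @ln R) (t ^+ 2) - (4^-1 \*: @ln R) (s ^+ 2)) =
      c / 2 * hyp_length (Vertical x) s t.
    by rewrite hyp_length_vertical//= !lnXn// /GRing.scale/=; field.
  exact.
move=> Delta; rewrite vertical_RM_cap// -[npoints _]/(ncard _).
rewrite ncard_image ?leqnn ?leqnSn// => xi xi'.
rewrite !inE => -[/pos xi0 _] [/pos xi'0 _] [] /(congr1 (fun y => y ^+ 2)).
by rewrite !sqr_sqrtr// ltW.
Qed.

Lemma npoints_semicircle (R : realType) (q : R) (r : {posnum R}) :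
  rational q -> rational (r%:num ^+ 2) ->
  exists2 C : R, 0 < C & forall s t, 0 < s -> s <= t -> t < pi ->
  (fun Delta =>
    (npoints (subarc (Semicircle q r) s t `&` RM_cap (Semicircle q r) Delta))%:R
    / Delta : R) @ +oo --> C * hyp_length (Semicircle q r) s t.
Proof.
move=> qQ rQ; have r0 : 0 < r%:num by [].
have rN : r%:num != 0 by rewrite gt_eqF.
have [c c0 hc] := ncard_pencil_points R _ _ (semicircle_discrete R q r qQ)
  (semicircle_full1 R q r qQ) (semicircle_full2 R q r qQ rQ).
exists (c / (4 * r%:num)); first by rewrite divr_gt0// mulr_gt0.
move=> s t s0 st tpi.
have ds : 0 < s < pi by rewrite s0 (le_lt_trans st).
have dt : 0 < t < pi by rewrite tpi (lt_le_trans s0).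
have dom' (th : R) : 0 < th < pi -> th \in `[0, pi].
  by move=> /andP[h1 h2]; rewrite in_itv/= !ltW.
have [s1 s2] := cos_lt1 _ s ds; have [t1 t2] := cos_lt1 _ t dt.
have pos xi : cos t / r%:num <= xi <= cos s / r%:num ->
    0 < 1 - r%:num * xi /\ 0 < 1 + r%:num * xi.
  by rewrite ler_pdivrMr// ler_pdivlMr// => /andP[h1 h2]; split; lra.
pose E xi : R := 4 * (1 - r%:num ^+ 2 * xi ^+ 2).
pose lin k : R -> R := cst 1 + (k * r%:num) \*: id.
(* Partial fractions of 1 / (4 (1 - r^2 xi^2)). At xi = cos th / r this is - [semicircle_primitive]
   th / (4 r), which explains the constant c / (4 r); the sign is undone by cos reversing the
   endpoints. *)
pose W := (8 * r%:num)^-1 \*: ((@ln R \o lin 1) - (@ln R \o lin (-1))).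
have linE k xi : lin k xi = 1 + k * r%:num * xi by [].
have WE th : W (cos th / r%:num) =
    (8 * r%:num)^-1 * (ln (1 + cos th) - ln (1 - cos th)).
  rewrite -[LHS]/((8 * r%:num)^-1 * (ln (lin 1 _) - ln (lin (-1) _))) !linE.
  by congr (_ * (ln _ - ln _)); field.
have [||||fin h] := hc E W (cos t / r%:num) (cos s / r%:num).
- by rewrite ler_pM2r ?invr_gt0// leNgt ltr_cos ?dom'// -leNgt.
- move=> xi /pos[h1 h2]; rewrite mulr_gt0//.
  have -> : 1 - r%:num ^+ 2 * xi ^+ 2 = (1 - r%:num * xi) * (1 + r%:num * xi) by ring.
  by rewrite mulr_gt0.
- move=> xi _; apply: cvgM; first exact: cvg_cst.
  apply: cvgB; first exact: cvg_cst.
  by apply: cvgM; [exact: cvg_cst|exact: exprn_continuous].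
- move=> xi /pos[h1 h2].
  have dlin k : is_derive xi 1 (lin k) (k * r%:num).
    by apply: is_derive_eq; rewrite add0r scaler1.
  have l1 : 0 < lin 1 xi by rewrite linE mul1r.
  have l2 : 0 < lin (-1) xi by rewrite linE mulN1r mulNr.
  have e1 := @is_derive1_comp _ (@ln R) (lin 1) xi _ _ (is_derive1_ln l1) (dlin 1).
  have e2 := @is_derive1_comp _ (@ln R) (lin (-1)) xi _ _ (is_derive1_ln l2) (dlin (-1)).
  apply: is_derive_eq; rewrite !linE /E /GRing.scale/=.
  have -> : 1 - r%:num ^+ 2 * xi ^+ 2 = (1 - r%:num * xi) * (1 + r%:num * xi) by ring.
  rewrite !mulN1r mul1r !mulNr; field.
  by rewrite !gt_eqF.
apply: (@cvg_div_of_approx _ (fun Delta => ncard (pencil_points R (semicircle_u R q)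
    (semicircle_v R q r) E (cos t / r%:num) (cos s / r%:num) Delta))); last first.
  move=> e e0; have := h e e0; apply: filterS => Delta.
  have -> : c * (W (cos s / r%:num) - W (cos t / r%:num)) =
      c / (4 * r%:num) * hyp_length (Semicircle q r) s t.
    rewrite hyp_length_semicircle// /semicircle_primitive.
    by rewrite !WE; field.
  exact.
move=> Delta; rewrite semicircle_RM_cap// -[npoints _]/(ncard _).
rewrite -/E; set P := pencil_points _ _ _ _ _ _ _.
have fP : finite_set P by exact: fin.
have fP0 : finite_set (P `\ 0) by exact: finite_setD.
rewrite ncard_image//; last first.
  move=> xi xi' _ _ []; move=> /addrI/(mulfI rN)/(mulfI rN) //.
apply/andP; split; first by apply: ncard_le => //; exact: subDsetl.
rewrite -addn1 -(ncard_set1 (0 : R)) -ncard_setU//; last first.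
  by rewrite setIC setDIK.
apply: ncard_le; first by rewrite finite_setU.
by move=> xi Pxi; have [->|/eqP xi0] := eqVneq xi 0; [right|left].
Qed.

Theorem theorem1p2 (R : realType) (G : geodesic R) (s1 t1 s2 t2 : R) :
  rational_geodesic G ->
  subarc_bounds G s1 t1 ->
  subarc_bounds G s2 t2 ->
  subarc G s1 t1 `<=` subarc G s2 t2 ->
  hyp_length G s2 t2 != 0 ->
  (fun Delta : R =>
     (npoints (subarc G s1 t1 `&` RM_cap G Delta))%:R /
     (npoints (subarc G s2 t2 `&` RM_cap G Delta))%:R : R) @ +oo%R
  --> hyp_length G s1 t1 / hyp_length G s2 t2.
Proof.
move=> rG b1 b2 _ len2.
(* C depends on G but not on the arc, so it cancels in the quotient. *)
have [C C0 hC] : exists2 C : R, 0 < C & forall s t, subarc_bounds G s t ->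
    (fun Delta => (npoints (subarc G s t `&` RM_cap G Delta))%:R / Delta : R) @ +oo
      --> C * hyp_length G s t.
  case: G rG {b1 b2 len2} => [x xQ|q r [qQ rQ]].
    have [C C0 hC] := npoints_vertical R x xQ.
    by exists C => // s t [/= s0 _ st]; exact: hC.
  have [C C0 hC] := npoints_semicircle R q r qQ rQ.
  by exists C => // s t [/= /andP[s0 _] /andP[_ tpi] st]; exact: hC.
have CN : C != 0 by rewrite gt_eqF.
have -> : hyp_length G s1 t1 / hyp_length G s2 t2 =
    C * hyp_length G s1 t1 / (C * hyp_length G s2 t2).
  by field; rewrite len2 CN.
apply: cvg_trans (cvgM (hC _ _ b1) (cvgV (mulf_neq0 CN len2) (hC _ _ b2))).
(* For Delta != 0 the two quotients agree even where the second count is 0, because 0^-1 = 0. *)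
apply: near_eq_cvg; near=> Delta.
have DN : Delta != 0.
  by rewrite gt_eqF//; near: Delta; exact: nbhs_pinfty_gt.
by rewrite /= invf_div mulrA divfK.
Unshelve. all: by end_near. Qed.
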